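(* Assume that the Banach space $X$ has the $\pi_\lambda$-property and that $(P_n)$ is a sequence of uniformly bounded finite rank projections approximating point-wise the identity on $X$. Let $(x_i,f_i)_{i\in\mathbb{N}}$ be a frame of $X$, with $(x_i)$ bounded, and assume that for an increasing sequence $(L_n)\subset\mathbb{N}$, $0<r,\delta,\varepsilon<1$ and $C<\infty$ the following conditions are satisfied: (a) for $n\in\mathbb{N}$ and $x\in X_n=P_n(X)$, $$\Big\|x-\sum_{i=1}^{L_n}f_i(x)P_n(x_i)\Big\|\le(1-r)\|x\|;$$ (b) $\|P_n(x_i)\|\ge r$ for all $n\in\mathbb{N}$ and $i\le L_n$; (c) for all $n\in\mathbb{N}$ and all $x\in\{\sum_{i=1}^{L_n}a_ix_i:|a_i|\le1\text{ for }i=1,2,\ldots,L_n\}$ there is a sequence $(k_i)_{i\le L_n}\subset\mathbb{Z}$ such that $$\Big\|x-\sum_{i=1}^{L_n}\delta k_ix_i\Big\|<\varepsilon\quad\text{and}\quad\max_{i\le L_n}|k_i|\delta\le C.$$ Then either there is a constant $c>0$ such that $L_n\ge c\,\dim P_n(X)\,\ln(\dim P_n(X))$ for all $n$, or the spaces $\{\ell_\infty^n:n\in\mathbb{N}\}$ are uniformly contained in $X$.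
   Context: All Banach spaces are real. $X$ has the $\pi_\lambda$-property if there is a sequence $(P_n)$ of finite rank projections on $X$ with $\sup_n\|P_n\|<\infty$ and $x=\lim_nP_n(x)$ in norm for all $x\in X$. A sequence $(x_i,f_i)_{i\in\mathbb{N}}$, $x_i\in X$, $f_i\in X^*$, is a (Schauder) frame of $X$ if $x=\sum_{i=1}^\infty f_i(x)x_i$ in norm for every $x\in X$. The spaces $\ell_\infty^n$ are uniformly contained in $X$ if there is a constant $\lambda<\infty$ such that for every $n$ the space $X$ contains an $n$-dimensional subspace which is $\lambda$-isomorphic to $\ell_\infty^n$. *)

(* Defs.v *)
From HB Require Import structures.
From mathcomp Require Export all_boot all_order all_algebra.
From mathcomp Require Export all_classical all_reals all_analysis.
Export Order.TTheory GRing.Theory Num.Theory.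
Export numFieldNormedType.Exports.

Set Implicit Arguments.
Unset Strict Implicit.
Unset Printing Implicit Defensive.

Local Open Scope classical_set_scope.
Local Open Scope ring_scope.

(* [A] is a linear subspace of dimension [d], i.e. the span of [d] linearly
   independent vectors. *)
Definition has_dim (R : realType) (X : lmodType R) (A : set X) (d : nat) :=
  exists e : 'I_d -> X,
    (forall a : 'I_d -> R, \sum_(i < d) a i *: e i = 0 -> forall i, a i = 0) /\
    A = range (fun a : 'I_d -> R => \sum_(i < d) a i *: e i).

Definition finite_dim (R : realType) (X : lmodType R) (A : set X) :=
  exists d, has_dim A d.

(* Meaningful only when [finite_dim A]; the default value is 0. *)
Definition lin_dim (R : realType) (X : lmodType R) (A : set X) : nat :=
  xget 0%N [set d | has_dim A d].

Lemma has_dim_le (R : realType) (X : lmodType R) (A : set X) d d' :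
  has_dim A d -> has_dim A d' -> (d <= d')%N.
Proof.
move=> [e [eI eA]] [e' [_ eA']]; rewrite leqNgt; apply/negP => dd'.
have ee' i : exists m : 'I_d' -> R, e i = \sum_j m j *: e' j.
  have : A (e i).
    rewrite eA; exists (fun j => (i == j)%:R) => //=.
    rewrite (bigD1 i)//= eqxx scale1r big1 ?addr0// => j.
    by rewrite eq_sym => /negbTE ->; rewrite scale0r.
  by rewrite eA' => -[m _ <-]; exists m.
have [m me] := choice ee'.
pose M := \matrix_(i < d, j < d') m i j.
have /rowV0Pn[u uM u0] : kermx M != 0.
  by rewrite -mxrank_eq0 mxrank_ker -lt0n subn_gt0 (leq_ltn_trans (rank_leq_col M)).
move/sub_kermxP in uM.
move/negP: u0; apply; apply/eqP/rowP => i; rewrite mxE.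
apply: (eI (u 0)).
under eq_bigr do rewrite me scaler_sumr.
rewrite exchange_big/= big1// => j _.
under eq_bigr do rewrite scalerA.
rewrite -scaler_suml.
have := congr1 (fun N : 'rV[R]_d' => N 0 j) uM; rewrite !mxE.
by under eq_bigr do rewrite mxE; move=> ->; rewrite scale0r.
Qed.

Lemma lin_dimE (R : realType) (X : lmodType R) (A : set X) d :
  has_dim A d -> lin_dim A = d.
Proof.
move=> Ad; rewrite /lin_dim; case: xgetP => [d' _ Ad'|/(_ d)//].
by apply/eqP; rewrite eqn_leq (has_dim_le Ad Ad') (has_dim_le Ad' Ad).
Qed.

Definition finite_rank_projection (R : realType) (X : normedModType R)
    (P : {linear X -> X}) :=
  [/\ continuous P, forall v, P (P v) = P v & finite_dim (range P)].

Definition uniformly_bounded (R : realType) (X : normedModType R)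
    (P : nat -> {linear X -> X}) :=
  exists M : R, forall n v, `|P n v| <= M * `|v|.

Definition approximating_projections (R : realType) (X : normedModType R)
    (P : nat -> {linear X -> X}) :=
  [/\ forall n, finite_rank_projection (P n), uniformly_bounded P &
      forall v : X, P n v @[n --> \oo] --> v].

Definition pi_lambda_property (R : realType) (X : normedModType R) :=
  exists P : nat -> {linear X -> X}, approximating_projections P.

Definition schauder_frame (R : realType) (X : normedModType R)
    (x : nat -> X) (f : nat -> {linear X -> R^o}) :=
  (forall i, continuous (f i)) /\
  (forall v : X, (fun n : nat => \sum_(i < n) f i v *: x i) @ \oo --> v).

(* There is a linear bijection [T] of [V] onto [E] with
   [||T|| * ||T^-1|| <= lambda]; [a] bounds [||T||] and [b] bounds
   [||T^-1||]. *)
Definition lambda_isomorphic (R : realType) (V X : normedModType R)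
    (lambda : R) (E : set X) :=
  exists T : {linear V -> X},
    [/\ injective T, range T = E &
        exists a b : R, [/\ 0 <= a, 0 <= b, forall v, `|T v| <= a * `|v|,
          forall v, `|v| <= b * `|T v| & a * b <= lambda]].

(* The norm of ['rV[R]_n] is the maximum of the absolute values of the entries,
   so this normed space is l_oo^n. *)
Definition linfty_uniformly_contained (R : realType) (X : normedModType R) :=
  exists lambda : R, forall n : nat,
    exists2 E : set X, has_dim E n & lambda_isomorphic 'rV[R]_n lambda E.

(* Main.v *)
(* If [X] does not contain the l_oo^n uniformly, James' blocking argument gives
   [theta < 1] and [N0] such that, for [m = N0 ^ k], any [m] vectors satisfy
   [sum |z_i|^2 <= m theta^k E|sum +-z_i|^2]: a cotype-like gain [theta^k], which
   is a power of [m].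

   Let [E = P_n X], of dimension [d], and suppose [L_n] is much smaller than
   [d ln d].  Sending [v] with [|f_i v| <= 1] to the quantization of
   [sum f_i(v) x_i] covers the set of such [v] by [K ^ L_n] (a small power
   [d ^ (c d)]) sets of bounded diameter.  By a volume count, the unit ball of [E]
   then contains a huge family separated in [max_i |f_i|] at the scale of a small
   negative power of [d].  A Sauer-Shelah argument makes this family shatter about
   [sqrt d] of the [f_i], i.e. it contains points [g(A)], one for each sign vector
   [A], on which those [f_i] follow the signs.  The Rademacher coefficients [z_i]
   of [g] are therefore not too small, so [E|sum +-z_i|^2] is at least a power of
   [d].  But the Rademacher projection on [E]-valued functions has norm at most an
   arbitrarily small power of [d] (Pisier's K-convexity argument: combine noise
   operators so that all low degrees except degree one cancel, and bound the
   remainder by Parseval in the coordinates [f_i]).  This is a contradiction. *)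

From HB Require Import structures.
Require Import Defs.
From mathcomp Require Import unstable ring lra zify.

Set Implicit Arguments.
Unset Strict Implicit.
Unset Printing Implicit Defensive.

(** * Shattering *)

Section level_shattering.
Import mathcomp.boot.finset.

(** A gap of two leaves a level strictly between the two values, to serve as a threshold. *)
Definition separated2 (I : finType) (p : nat) (F : {set {ffun I -> 'I_p}}) :=
  forall g h, g \in F -> h \in F -> g != h ->
    exists i, (((g i).+1 < h i) || ((h i).+1 < g i))%N.

(* [s i = Some u] means that coordinate [i] is shattered at level [u]. *)
Definition shatters (I : finType) (p : nat) (F : {set {ffun I -> 'I_p}})
    (s : {ffun I -> option 'I_p}) : bool :=
  [forall A : {set I}, exists g in F, forall i,
     if s i is Some u then (if i \in A then u < g i else g i < u)%N else true].

(* Discarding the functions that take a rare value at some coordinate leaves two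
   separated ones, hence two frequent and distant values at some coordinate. *)
Lemma heavy_levels (I : finType) (p m : nat) (F : {set {ffun I -> 'I_p}}) :
  separated2 F -> (#|I| * p * m + 1 < #|F|)%N ->
  exists (i : I) (u v : 'I_p), [/\ (u.+1 < v)%N,
    (m <= #|[set g in F | g i == u]|)%N & (m <= #|[set g in F | g i == v]|)%N].
Proof.
move=> sepF; apply: contraPP => nheavy; apply/negP; rewrite -leqNgt.
pose light := \bigcup_(x : I * 'I_p | (#|[set g in F | g x.1 == x.2]| < m)%N)
                 [set g in F | g x.1 == x.2].
have light_le : (#|light| <= #|I| * p * m)%N.
  rewrite (leq_trans (card_big_setU _ _ _))//.
  rewrite (@leq_trans (\sum_(x : I * 'I_p) m))//; last first.
    by rewrite sum_nat_const card_prod card_ord.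
  by rewrite big_mkcond/= leq_sum// => x _; case: ifP => // /ltnW.
have heavy_le1 : (#|F :\: light| <= 1)%N.
  apply/card_le1P => g /setDP[gF gl] h; apply/idP/idP => [/setDP[hF hl]|]; last first.
    by rewrite inE => /eqP ->; rewrite !inE gl gF.
  rewrite inE; apply/negPn/negP => gh.
  have heavy k j : k \in F -> k \notin light ->
      (m <= #|[set g in F | g j == k j]|)%N.
    move=> kF; rewrite leqNgt; apply: contra => lt_m.
    by apply/bigcupP; exists (j, k j); rewrite // inE kF/=.
  have [j /orP[]] := sepF _ _ hF gF gh => lt; apply: nheavy.
    by exists j, (h j), (g j); split => //; exact: heavy.
  by exists j, (g j), (h j); split => //; exact: heavy.
rewrite -(cardsID light F) leq_add//.
by rewrite (leq_trans (subset_leq_card (subsetIr _ _))).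
Qed.

(** Sauer-Shelah induction in Pajor's form, which counts shattered patterns. Cut [F] to the slices
    [g i = u] and [g i = v] given by [heavy_levels]: a pattern shattered by both slices yields a
    second one in which [i] is shattered too, so the counts of the two slices add up. *)
Lemma card_shatters (I : finType) (p k : nat) (F : {set {ffun I -> 'I_p}}) :
  separated2 F -> ((#|I| * p + 2) ^ k <= #|F|)%N ->
  (2 ^ k <= #|[set s | shatters F s]|)%N.
Proof.
elim: k F => [|k IH] F sepF leF.
  rewrite expn0; apply/card_gt0P; exists [ffun=> None].
  rewrite inE; apply/forallP => A.
  have /card_gt0P[g gF] : (0 < #|F|)%N by rewrite (leq_trans _ leF)// expn0.
  by apply/existsP; exists g; rewrite gF; apply/forallP => i; rewrite ffunE.
set m := ((#|I| * p + 2) ^ k)%N in IH.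
have m0 : (0 < m)%N by rewrite expn_gt0 addn2.
have [|i [u [v [uv mu mv]]]] := @heavy_levels I p m F sepF.
  by rewrite (leq_trans _ leF)// expnS -/m; nia.
have sub (w : 'I_p) : separated2 [set g in F | g i == w].
  by move=> g h; rewrite !inE => /andP[gF _] /andP[hF _]; exact: sepF.
have shF w s : s \in [set s | shatters [set g in F | g i == w] s] ->
    shatters F s /\ s i = None.
  rewrite inE => /forallP sh; split.
    apply/forallP => A; have /existsP[g /andP[]] := sh A.
    by rewrite inE => /andP[gF _] gs; apply/existsP; exists g; rewrite gF.
  case Esi : (s i) => [a|//].
  have /existsP[g /andP[]] := sh [set: I].
  rewrite inE => /andP[_ /eqP gw] /forallP/(_ i); rewrite Esi inE gw.
  have /existsP[h /andP[]] := sh set0.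
  rewrite inE => /andP[_ /eqP hw] /forallP/(_ i); rewrite Esi inE hw.
  by move=> wa aw; have := ltn_trans aw wa; rewrite ltnn.
(* The threshold at [i] is [u.+1]: the slice at [v] supplies the functions above it, the slice at
   [u] those below. *)
have u1p : (u.+1 < p)%N by rewrite (ltn_trans uv).
pose up (s : {ffun I -> option 'I_p}) :=
  [ffun j => if j == i then Some (Ordinal u1p) else s j].
have := IH _ (sub u) mu; have := IH _ (sub v) mv.
set Sv := [set s | _]; set Su := [set s | _] => leSv leSu.
have up_inj : {in Sv :&: Su &, injective up}.
  move=> s t /setIP[/shF[_ si] _] /setIP[/shF[_ ti] _] /ffunP st.
  apply/ffunP => j; have := st j; rewrite !ffunE; case: eqP => // ->.
  by rewrite si ti.
have subU : (Sv :|: Su) :|: up @: (Sv :&: Su) \subset [set s | shatters F s].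
  apply/fintype.subsetP => s; rewrite in_setU => /orP[|].
    by rewrite [in X in _ -> X]inE => /setUP[] /shF[].
  move=> /imsetP[t /setIP[tv tu] ->]; rewrite inE; apply/forallP => A.
  have [iA|iA] := boolP (i \in A).
    move: (tv); rewrite inE => /forallP/(_ A)/existsP[g /andP[]].
    rewrite inE => /andP[gF /eqP gv] /forallP gt.
    apply/existsP; exists g; rewrite gF; apply/forallP => j; rewrite ffunE.
    by case: eqP => [->|_]; [rewrite iA gv|exact: gt].
  move: (tu); rewrite inE => /forallP/(_ A)/existsP[g /andP[]].
  rewrite inE => /andP[gF /eqP gv] /forallP gt.
  apply/existsP; exists g; rewrite gF; apply/forallP => j; rewrite ffunE.
  by case: eqP => [->|_]; [rewrite (negbTE iA) gv|exact: gt].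
have dis : [disjoint Sv :|: Su & up @: (Sv :&: Su)].
  rewrite disjoints_subset; apply/fintype.subsetP => s sU; rewrite in_setC.
  apply/negP => /imsetP[t _ st].
  have : s i = None by move: sU => /setUP[] /shF[].
  by rewrite st ffunE eqxx.
rewrite (leq_trans _ (subset_leq_card subU))// cardsU (disjoint_setI0 dis).
rewrite cards0 subn0 card_in_imset// cardsU subnK; last first.
  by rewrite (leq_trans (subset_leq_card (subsetIl _ _)))// leq_addr.
by rewrite expnS mul2n -addnn leq_add.
Qed.

Definition supp (I : finType) (p : nat) (s : {ffun I -> option 'I_p}) : {set I} :=
  [set i | s i != None].

(** Each such pattern is decoded from [D] optional pairs of a coordinate and a level, padded with
    [None]. *)
Lemma card_small_supp (I : finType) (p D : nat) :
  (#|[set s : {ffun I -> option 'I_p} | #|supp s| <= D]| <= (#|I| * p + 1) ^ D)%N.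
Proof.
pose dec (t : {ffun 'I_D -> option (I * 'I_p)}) : {ffun I -> option 'I_p} :=
  [ffun i => omap snd [pick x : I * 'I_p | (x.1 == i) && [exists j, t j == Some x]]].
rewrite (@leq_trans #|dec @: setT|)//; last first.
  rewrite (leq_trans (leq_imset_card _ _))// cardsT card_ffun card_ord.
  by rewrite card_option card_prod card_ord addn1.
apply/subset_leq_card/fintype.subsetP => s; rewrite inE => sD.
pose t : {ffun 'I_D -> option (I * 'I_p)} := [ffun j : 'I_D =>
  if onth (enum (supp s)) j is Some i then omap (pair i) (s i) else None].
apply/imsetP; exists t => //; apply/ffunP => i; rewrite ffunE.
case: pickP => [[i' u] /= /andP[/eqP -> /existsP[j /eqP]]|none].
  rewrite ffunE; case: onth => // a.
  by case E: (s a) => [b|]//= [<- <-].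
case E : (s i) => [u|//]; have := none (i, u); rewrite /= eqxx/= => /negbT/negP[].
have iin : i \in enum (supp s) by rewrite mem_enum inE E.
have lt : (index i (enum (supp s)) < D)%N.
  by rewrite (leq_trans _ sD)// cardE index_mem.
apply/existsP; exists (Ordinal lt); rewrite ffunE/=.
by rewrite onthE (nth_map i) ?index_mem// nth_index// E.
Qed.

(** There are at least [2 ^ (D * e).+1] shattered patterns, but at most [2 ^ (e * D)] patterns with
    support of size at most [D]. *)
Lemma large_shattered (I : finType) (p D e : nat) (F : {set {ffun I -> 'I_p}}) :
  separated2 F -> (#|I| * p + 2 <= 2 ^ e)%N ->
  (2 ^ (e * (D * e).+1) <= #|F|)%N ->
  exists2 s, shatters F s & (D < #|supp s|)%N.
Proof.
move=> sepF le_e leF.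
have := @card_shatters I p (D * e).+1 F sepF.
rewrite (leq_trans _ leF); last by rewrite expnM leq_exp2r.
move=> /(_ isT) le_sh; apply: contrapT => noex.
have : (2 ^ (D * e).+1 <= (#|I| * p + 1) ^ D)%N.
  rewrite (leq_trans le_sh)// (leq_trans _ (card_small_supp I p D))//.
  apply/subset_leq_card/fintype.subsetP => s; rewrite !inE => sh.
  by rewrite leqNgt; apply/negP => ?; apply: noex; exists s.
apply/negP; rewrite -ltnNge (@leq_ltn_trans ((2 ^ e) ^ D))//.
  by case: (D) => // ?; rewrite leq_exp2r// (leq_trans _ le_e)// leq_add2l.
by rewrite -expnM mulnC ltn_exp2l.
Qed.

End level_shattering.

(** * Functions on the sign cube *)

Section sign_cube.
Import mathcomp.boot.finset.
Local Open Scope ring_scope.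
Context {R : realType} {I : finType}.
Implicit Types (A B S : {set I}) (i : I).

Definition sgn A i : R := (-1) ^+ (i \in A).

Definition walsh S A : R := \prod_(i in S) sgn A i.

Lemma normr_sgn A i : `|sgn A i| = 1.
Proof. by rewrite /sgn; case: (_ \in _); rewrite ?expr1 ?normrN normr1. Qed.

Lemma sgn_mul A i : sgn A i * sgn A i = 1.
Proof. by rewrite -expr2 -exprM mulnC exprM sqrrN !expr1n. Qed.

(** When every [c i] is in [-1, 1] these Riesz products are nonnegative; divided by [2 ^+ #|I|] they
    are probability densities on the cube, with mean sign [c i] at [i]. *)
Lemma cube_kernel_sum (c : I -> R) :
  \sum_(A : {set I}) \prod_i (1 + c i * sgn A i) = 2 ^+ #|I|.
Proof.
have -> : 2 ^+ #|I| = \prod_(i : I) ((1 - c i) + (1 + c i)) :> R.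
  by rewrite -[LHS]prodr_const; apply: eq_bigr => i _; rewrite addrACA addNr addr0.
rewrite bigA_distr; apply: eq_bigr => A _; apply: eq_bigr => i _.
by rewrite /sgn; case: (i \in A); rewrite ?mulrN1 ?mulr1.
Qed.

Lemma sum_cube (a : R) : \sum_(A : {set I}) a = 2 ^+ #|I| * a.
Proof.
rewrite -(cube_kernel_sum (fun=> 0)) mulr_suml; apply: eq_bigr => A _.
by rewrite big1 ?mul1r// => i _; rewrite mul0r addr0.
Qed.

Lemma cube_kernel_ge0 (c : I -> R) A : (forall i, `|c i| <= 1) ->
  0 <= \prod_i (1 + c i * sgn A i).
Proof.
move=> c1; apply: prodr_ge0 => i _.
have : `|c i * sgn A i| <= 1 by rewrite normrM normr_sgn mulr1.
by rewrite ler_norml => /andP[+ _]; rewrite -subr_ge0 opprK addrC.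
Qed.

Lemma walshC S A : walsh S A = walsh A S.
Proof.
rewrite /walsh /sgn big_mkcond [RHS]big_mkcond/=; apply: eq_bigr => i _.
by case: (i \in S); case: (i \in A).
Qed.

(** Up to normalization, the left side is the kernel of the noise operator of parameter [t]; the
    right side shows that it multiplies Walsh degree [k] by [t ^+ k]. *)
Lemma walsh_kernel (t : R) A B :
  \prod_i (1 + t * sgn B i * sgn A i) = \sum_(S : {set I}) t ^+ #|S| * walsh S A * walsh S B.
Proof.
under eq_bigr do rewrite addrC.
rewrite bigA_distr; apply: eq_bigr => S _.
rewrite -big_mkcond/= !big_split/= prodr_const.
by rewrite -!mulrA [X in _ * X]mulrC.
Qed.

(** This is the noise kernel at [t = 1], in which a coordinate where [A] and [B] differ gives a zero
    factor. *)
Lemma walsh_orthogonal A B :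
  \sum_(S : {set I}) walsh S A * walsh S B = if A == B then 2 ^+ #|I| else 0.
Proof.
have := walsh_kernel 1 A B; under [RHS]eq_bigr do rewrite expr1n mul1r.
move=> <-; case: eqVneq => [->|AB].
  by under eq_bigr do rewrite mul1r sgn_mul; rewrite prodr_const.
have [i iAB] : exists i, (i \in A) != (i \in B).
  apply/existsP; apply: contraNT AB => /existsPn AB.
  by apply/eqP/setP => i; apply/eqP; rewrite -[_ == _]negbK AB.
rewrite (bigD1 i)//= /sgn; move: iAB.
by case: (i \in A); case: (i \in B) => //= _; rewrite expr1 expr0 !mul1r ?mulr1 subrr mul0r.
Qed.

Lemma walsh_parseval (a : {set I} -> R) :
  \sum_(A : {set I}) (\sum_(S : {set I}) a S * walsh S A) ^+ 2 = 2 ^+ #|I| * \sum_(S : {set I}) a S ^+ 2.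
Proof.
under eq_bigr => A _.
  rewrite expr2 mulr_suml; under eq_bigr do rewrite mulr_sumr; over.
rewrite /= exchange_big mulr_sumr/=; apply: eq_bigr => S _.
rewrite exchange_big/= (bigD1 S)//= [X in _ + X]big1 ?addr0 => [|T TS].
  under eq_bigr do rewrite mulrACA -expr2 walshC.
  by rewrite -mulr_sumr walsh_orthogonal eqxx mulrC.
under eq_bigr do rewrite mulrACA walshC [walsh T _]walshC.
by rewrite -mulr_sumr walsh_orthogonal eq_sym (negbTE TS) mulr0.
Qed.

(** Parseval on both sides: the operator scales degree [k] by [rho k]. The factor [(2 ^+ #|I|) ^+ 2]
    comes from the unnormalized kernel. *)
Lemma walsh_multiplier (rho : nat -> R) (M : R) (phi : {set I} -> R) :
  (forall k, `|rho k| <= M) ->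
  \sum_(A : {set I}) (\sum_(B : {set I}) (\sum_(S : {set I}) rho #|S| * walsh S A * walsh S B) * phi B) ^+ 2
    <= (2 ^+ #|I|) ^+ 2 * M ^+ 2 * \sum_(B : {set I}) phi B ^+ 2.
Proof.
move=> rhoM.
pose hat S := \sum_(B : {set I}) phi B * walsh B S.
have -> : \sum_(A : {set I}) (\sum_(B : {set I}) (\sum_(S : {set I}) rho #|S| * walsh S A * walsh S B) * phi B) ^+ 2
    = \sum_(A : {set I}) (\sum_(S : {set I}) (rho #|S| * hat S) * walsh S A) ^+ 2.
  apply: eq_bigr => A _; congr (_ ^+ 2).
  under eq_bigr do rewrite mulr_suml.
  rewrite exchange_big/=; apply: eq_bigr => S _.
  rewrite /hat mulr_sumr mulr_suml; apply: eq_bigr => B _.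
  by rewrite [walsh B S]walshC; ring.
have hatE : \sum_(S : {set I}) hat S ^+ 2 = 2 ^+ #|I| * \sum_(B : {set I}) phi B ^+ 2.
  exact: walsh_parseval.
rewrite walsh_parseval [(2 ^+ #|I|) ^+ 2]expr2 -(mulrA (_ * _)) -(mulrA (2 ^+ #|I|)) ler_wpM2l ?exprn_ge0//.
rewrite mulrCA -hatE mulr_sumr.
apply: ler_sum => S _.
rewrite exprMn ler_wpM2r ?sqr_ge0// -real_normK ?num_real//.
by rewrite lerXn2r ?nnegrE// (le_trans (normr_ge0 _) (rhoM 0%N)).
Qed.

Lemma sum_sgn i : \sum_(A : {set I}) sgn A i = 0.
Proof.
have iN0 : ([set i] == set0) = false by apply/negbTE/set0Pn; exists i; rewrite inE.
have := walsh_orthogonal [set i] set0; rewrite iN0 => h; rewrite -[RHS]h.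
apply: eq_bigr => A _; rewrite [walsh A set0]walshC [walsh A _]walshC /walsh.
by rewrite big_set1 big_set0 mulr1.
Qed.

Lemma sum_walsh1 A B :
  \sum_(S : {set I}) (#|S| == 1%N)%:R * walsh S A * walsh S B
  = \sum_i sgn A i * sgn B i.
Proof.
under eq_bigr do rewrite -mulrA mulr_natl mulrb.
rewrite -big_mkcond/= big_cards1; apply: eq_bigr => i _.
by rewrite /walsh !big_set1.
Qed.

End sign_cube.

(** * The Rademacher projection *)

Local Open Scope classical_set_scope.
Local Open Scope ring_scope.

Definition is_subspace (R : realType) (X : lmodType R) (E : set X) :=
  E 0 /\ forall a u v, E u -> E v -> E (a *: u + v).

Lemma has_dim_subspace (R : realType) (X : lmodType R) (E : set X) d :
  has_dim E d -> is_subspace E.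
Proof.
move=> [e [_ ->]]; split.
  by exists (fun=> 0) => //; rewrite big1// => i _; rewrite scale0r.
move=> a _ _ [u _ <-] [v _ <-]; exists (fun i => a * u i + v i) => //.
rewrite scaler_sumr -big_split/=; apply: eq_bigr => i _.
by rewrite scalerDl scalerA.
Qed.

Lemma subspaceZ (R : realType) (X : lmodType R) (E : set X) a u :
  is_subspace E -> E u -> E (a *: u).
Proof. by move=> [E0 EE] Eu; rewrite -[_ *: _]addr0; exact: EE. Qed.

Lemma subspaceB (R : realType) (X : lmodType R) (E : set X) u v :
  is_subspace E -> E u -> E v -> E (u - v).
Proof. by move=> [E0 EE] Eu Ev; rewrite addrC -scaleN1r; exact: EE. Qed.

Lemma subspace_sum (R : realType) (X : lmodType R) (E : set X) (I : Type)
    (r : seq I) (a : I -> R) (u : I -> X) :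
  is_subspace E -> (forall i, E (u i)) -> E (\sum_(i <- r) a i *: u i).
Proof.
move=> [E0 EE] Eu; elim: r => [|i r IH]; first by rewrite big_nil.
by rewrite big_cons; exact: EE.
Qed.

Lemma sqr_sum_le (R : realType) (L : finType) (a : L -> R) :
  (\sum_l a l) ^+ 2 <= #|L|%:R * \sum_l a l ^+ 2.
Proof.
rewrite -subr_ge0 -(pmulr_rge0 _ (ltr0n R 2)).
suff -> : 2%:R * (#|L|%:R * \sum_l a l ^+ 2 - (\sum_l a l) ^+ 2) =
    \sum_l \sum_k (a l - a k) ^+ 2.
  by apply: sumr_ge0 => l _; apply: sumr_ge0 => k _; exact: sqr_ge0.
have E l : \sum_k (a l - a k) ^+ 2 =
    #|L|%:R * a l ^+ 2 + \sum_k a k ^+ 2 - 2 * (a l * \sum_k a k).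
  rewrite !mulr_sumr mulr_natl -sumr_const -big_split -sumrB/=.
  by apply: eq_bigr => k _; ring.
under [RHS]eq_bigr do rewrite E.
rewrite sumrB big_split/= sumr_const -!mulr_sumr -mulr_suml -mulr_natl cardT -cardE.
ring.
Qed.

(* Richardson extrapolation of the derivative at 0: halving the nodes and
   recombining kills one more moment. *)
Lemma derivative_nodes (R : realType) (q : nat) :
  exists s : seq (R * R), (forall p, p \in s -> 0 <= p.2 <= 1) /\
    forall k, (k < q.+2)%N -> \sum_(p <- s) p.1 * p.2 ^+ k = (k == 1%N)%:R.
Proof.
elim: q => [|q [s [s01 sk]]].
  exists [:: (-1, 0); (1, 1)]; split.
    by move=> p; rewrite !inE => /orP[] /eqP -> /=; rewrite ?lexx ?ler01.
  case=> [|[|//]] _; rewrite !big_cons big_nil/=.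
    by rewrite !expr0; ring.
  by rewrite !expr1; ring.
(* The new nodes multiply the [k]-th moment by [d^-1 * (2^-1 ^+ k - 2^-1 ^+ q.+2)], which is 0 for
   [k = q.+2] and 1 for [k = 1]. *)
pose d : R := 2^-1 - 2^-1 ^+ q.+2.
have d0 : d != 0.
  rewrite /d subr_eq0 gt_eqF// exprS gtr_pMr ?invr_gt0//.
  by rewrite exprn_ilt1// ?invr_ge0// invf_lt1// ltr1n.
exists ([seq (- d^-1 * 2^-1 ^+ q.+2 * p.1, p.2) | p <- s] ++
        [seq (d^-1 * p.1, 2^-1 * p.2) | p <- s]); split.
  move=> p; rewrite mem_cat => /orP[] /mapP[p' /s01 /andP[p0 p1] ->]/=.
    by rewrite p0.
  by rewrite mulr_ge0//= mulr_ile1// invf_le1// ler1n.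
move=> k kq; rewrite big_cat !big_map/=.
have -> : \sum_(p <- s) - d^-1 * 2^-1 ^+ q.+2 * p.1 * p.2 ^+ k =
    - d^-1 * 2^-1 ^+ q.+2 * \sum_(p <- s) p.1 * p.2 ^+ k.
  by rewrite mulr_sumr; apply: eq_bigr => p _; rewrite !mulrA.
have -> : \sum_(p <- s) d^-1 * p.1 * (2^-1 * p.2) ^+ k =
    d^-1 * 2^-1 ^+ k * \sum_(p <- s) p.1 * p.2 ^+ k.
  by rewrite mulr_sumr; apply: eq_bigr => p _; rewrite exprMn; ring.
move: kq; rewrite ltnS leq_eqVlt => /orP[/eqP ->|/sk ->].
  by rewrite -mulrDl mulNr addNr mul0r.
case: eqP => [->|_]; last by rewrite !mulr0 addr0.
rewrite !mulr1 expr1 mulNr addrC -mulrBr.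
by rewrite mulVf.
Qed.

Definition rademacher_coef (R : realType) (X : normedModType R) (I : finType)
    (g : {set I} -> X) (i : I) : X :=
  (2 ^+ #|I|)^-1 *: \sum_(B : {set I}) (sgn B i : R) *: g B.

(** The multiplier on Walsh degree [k] of a combination of noise operators minus the projection on
    degree one. *)
Definition moment_defect (R : realType) (s : seq (R * R)) (k : nat) : R :=
  \sum_(p <- s) p.1 * p.2 ^+ k - (k == 1%N)%:R.

(** The Rademacher kernel is [W - Q], with [W] a combination of noise kernels and [Q] the kernel of
    the multiplier [moment_defect s]. Noise operators are averages, so [U] is bounded pointwise by
    the total weight of [s]. The remainder [V] is bounded in mean square on each scalar coordinate
    [f l], at the price of the factor [C3 * #|L|%:R]. *)
Lemma rademacher_projection_le (R : realType) (X : normedModType R) (E : set X)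
    (I L : finType) (f : L -> {linear X -> R^o}) (C1 C3 M : R)
    (g : {set I} -> X) (s : seq (R * R)) :
  is_subspace E -> (forall A, E (g A)) -> (forall A, `|g A| <= 1) ->
  (forall l A, `|f l (g A)| <= C1) ->
  (forall v, E v -> `|v| <= C3 * \sum_l `|f l v|) ->
  (forall p, p \in s -> 0 <= p.2 <= 1) ->
  (forall k, `|moment_defect s k| <= M) ->
  \sum_(A : {set I}) `|\sum_i (sgn A i : R) *: rademacher_coef g i| ^+ 2 <=
    2 ^+ #|I| * (2 * (\sum_(p <- s) `|p.1|) ^+ 2 +
                 2 * (C3 * #|L|%:R * C1 * M) ^+ 2).
Proof.
move=> subE Eg g1 fg Ef s01 sM.
pose N : R := 2 ^+ #|I|.
have N0 : 0 < N by rewrite exprn_gt0.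
pose W (A B : {set I}) : R :=
  \sum_(p <- s) p.1 * \prod_i (1 + p.2 * sgn B i * sgn A i).
pose Q (A B : {set I}) : R :=
  \sum_(S : {set I}) moment_defect s #|S| * walsh S A * walsh S B.
have WQ A B : \sum_i (sgn A i : R) * sgn B i = W A B - Q A B.
  have -> : W A B = \sum_(S : {set I})
      (\sum_(p <- s) p.1 * p.2 ^+ #|S|) * walsh S A * walsh S B.
    under [RHS]eq_bigr do rewrite -mulrA mulr_suml.
    rewrite exchange_big/=; apply: eq_bigr => p _.
    rewrite walsh_kernel mulr_sumr; apply: eq_bigr => S _; rewrite !mulrA//.
  rewrite -sum_walsh1 -sumrB; apply: eq_bigr => S _.
  by rewrite /moment_defect -!mulrBl opprB addrC subrK.
pose U A := N^-1 *: \sum_(B : {set I}) W A B *: g B.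
pose V A := N^-1 *: \sum_(B : {set I}) Q A B *: g B.
have UV A : \sum_i (sgn A i : R) *: rademacher_coef g i = U A - V A.
  rewrite -scalerBr -sumrB.
  under [in RHS]eq_bigr do rewrite -scalerBl -WQ scaler_suml.
  rewrite exchange_big/= scaler_sumr; apply: eq_bigr => i _.
  rewrite /rademacher_coef scalerA mulrC -scalerA scaler_sumr; congr (_ *: _).
  by apply: eq_bigr => B _; rewrite scalerA.
pose c := \sum_(p <- s) `|p.1|.
have Ule A : `|U A| <= c.
  rewrite normrZ gtr0_norm ?invr_gt0// ler_pdivrMl//.
  rewrite (le_trans (ler_norm_sum _ _ _))//.
  apply: (@le_trans _ _ (\sum_(B : {set I}) \sum_(p <- s)
      `|p.1| * \prod_i (1 + p.2 * sgn A i * sgn B i))).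
    apply: ler_sum => B _; rewrite normrZ.
    rewrite (le_trans (ler_wpM2l (normr_ge0 _) (g1 B)))// mulr1.
    rewrite (le_trans (ler_norm_sum _ _ _))// big_seq [leRHS]big_seq.
    apply: ler_sum => p /s01 /andP[p0 p1].
    rewrite normrM ler_wpM2l// ger0_norm//.
      by rewrite le_eqVlt; apply/orP; left; apply/eqP/eq_bigr => i _; rewrite mulrAC.
    apply: cube_kernel_ge0 => i.
    by rewrite normrM normr_sgn mulr1 ger0_norm.
  rewrite exchange_big mulr_sumr/= le_eqVlt; apply/orP; left; apply/eqP.
  by apply: eq_bigr => p _; rewrite -mulr_sumr cube_kernel_sum mulrC.
have EV A : E (V A).
  by apply: subspaceZ => //; apply: subspace_sum.
(* If [C3] is negative, [Ef] makes every vector of [E] vanish. *)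
have C30 : 0 <= C3 \/ forall A, V A = 0.
  have [|C30] := leP 0 C3; [by left|right] => A; apply/eqP.
  rewrite -normr_le0 (le_trans (Ef _ (EV A)))// mulr_le0_ge0 ?(ltW C30)//.
  by apply: sumr_ge0.
have Vle : \sum_(A : {set I}) `|V A| ^+ 2 <= N * (C3 * #|L|%:R * C1 * M) ^+ 2.
  case: C30 => [C30|V0]; last first.
    rewrite big1; last by move=> A _; rewrite V0 normr0 expr0n.
    by rewrite mulr_ge0 ?sqr_ge0// ltW.
  apply: (@le_trans _ _ (\sum_(A : {set I})
      C3 ^+ 2 * (#|L|%:R * \sum_l `|f l (V A)| ^+ 2))).
    apply: ler_sum => A _.
    apply: (@le_trans _ _ ((C3 * \sum_l `|f l (V A)|) ^+ 2)).
      by rewrite lerXn2r ?nnegrE ?normr_ge0 ?Ef// mulr_ge0// sumr_ge0.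
    by rewrite exprMn ler_wpM2l ?sqr_ge0// sqr_sum_le.
  rewrite -mulr_sumr -mulr_sumr exchange_big/=.
  have fV l : \sum_(A : {set I}) `|f l (V A)| ^+ 2 <= N * (C1 * M) ^+ 2.
    have -> : \sum_(A : {set I}) `|f l (V A)| ^+ 2 =
        N^-1 ^+ 2 * \sum_(A : {set I}) (\sum_(B : {set I}) Q A B * f l (g B)) ^+ 2.
      rewrite mulr_sumr; apply: eq_bigr => A _.
      rewrite real_normK ?num_real// -exprMn; congr (_ ^+ 2).
      rewrite linearZ/= linear_sum/=; congr (_ * _).
      by apply: eq_bigr => B _; rewrite linearZ.
    rewrite exprVn ler_pdivrMl ?exprn_gt0//.
    rewrite (le_trans (@walsh_multiplier R I _ M _ sM))//.
    have -> : N ^+ 2 * (N * (C1 * M) ^+ 2) = N ^+ 2 * M ^+ 2 * (N * C1 ^+ 2).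
      by ring.
    rewrite ler_wpM2l ?(mulr_ge0 (sqr_ge0 _) (sqr_ge0 _))//.
    apply: (@le_trans _ _ (\sum_(B : {set I}) C1 ^+ 2)).
      apply: ler_sum => B _; rewrite -real_normK ?num_real// lerXn2r ?nnegrE//.
      exact: le_trans (fg l B).
    by rewrite sum_cube.
  apply: (@le_trans _ _ (C3 ^+ 2 * (#|L|%:R * \sum_(l : L) (N * (C1 * M) ^+ 2)))).
    by rewrite !ler_wpM2l ?sqr_ge0// ler_sum.
  rewrite sumr_const -mulr_natl cardT -cardE.
  by rewrite le_eqVlt; apply/orP; left; apply/eqP; ring.
rewrite -/N -/c.
apply: (@le_trans _ _ (\sum_(A : {set I}) (2 * c ^+ 2 + 2 * `|V A| ^+ 2))).
  apply: ler_sum => A _; rewrite UV.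
  have := Ule A; have := ler_normB (U A) (V A).
  have := normr_ge0 (U A - V A); have := normr_ge0 (U A); have := normr_ge0 (V A).
  move: `|_ - _| `|V A| `|U A| => x v u v0 u0 x0 xuv uc.
  by have := sqr_ge0 (u - v); nra.
rewrite big_split/= sum_cube -mulr_sumr -/N mulrDr lerD2l.
by rewrite [leRHS]mulrCA ler_wpM2l.
Qed.

(** * Cotype versus copies of l_oo^n *)

(** A cotype 2 inequality with [K] in front of the mean over signs, cleared of the denominator
    [2 ^+ #|I|]. Each [z i] has norm at most the mean norm of the sign sums, so [K = #|I|] always
    works; only a smaller [K] is a gain. *)
Definition cotype_bound (R : realType) (X : normedModType R) (I : finType)
    (K : R) :=
  forall z : I -> X, 2 ^+ #|I| * \sum_i `|z i| ^+ 2 <=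
    K * \sum_(A : {set I}) `|\sum_i (sgn A i : R) *: z i| ^+ 2.

Lemma sum_cube_translate (R : realType) (I : finType) (T : {set I})
    (F : {set I} -> R) :
  \sum_(A : {set I}) F [set x | (x \in T) (+) (x \in A)]%SET =
  \sum_(A : {set I}) F A.
Proof.
rewrite [RHS](reindex_inj (h := fun A : {set I} => [set x | (x \in T) (+) (x \in A)]%SET))//.
by move=> A B /setP AB; apply/setP => i; have := AB i; rewrite !inE => /addbI.
Qed.

(** Translations preserve the counting measure of the cube, so a random translation by [h B] may be
    inserted; it multiplies the signs by fresh ones. *)
Lemma sum_cube_randomize (R : realType) (I J : finType) (h : {set J} -> {set I})
    (F : {set I} -> R) :
  2 ^+ #|J| * \sum_(A : {set I}) F A =
  \sum_(A : {set I}) \sum_(B : {set J}) F [set x | (x \in h B) (+) (x \in A)]%SET.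
Proof.
rewrite -sum_cube [RHS]exchange_big/=; apply: eq_bigr => B _.
exact/esym/sum_cube_translate.
Qed.

Lemma sgn_translate (R : realType) (I : finType) (T A : {set I}) i :
  sgn [set x | (x \in T) (+) (x \in A)]%SET i = sgn T i * sgn A i :> R.
Proof. by rewrite /sgn inE signr_addb. Qed.

(** Fresh signs depending only on the row [i] allow the inequality over [I] to be applied to the row
    sums [u A i]; fresh signs depending only on the column [j] then treat each row. *)
Lemma cotype_bound_prod (R : realType) (X : normedModType R) (I J : finType)
    (K1 K2 : R) : 0 <= K2 ->
  cotype_bound X I K1 -> cotype_bound X J K2 ->
  cotype_bound X (I * J)%type (K1 * K2).
Proof.
move=> K20 cI cJ z.
pose u (A : {set I * J}) i : X := \sum_j (sgn A (i, j) : R) *: z (i, j).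
have uE A : \sum_x (sgn A x : R) *: z x = \sum_i u A i.
  by rewrite pair_big/=; apply: eq_bigr => -[].
have step1 : \sum_i \sum_(A : {set I * J}) `|u A i| ^+ 2 <=
    K1 * \sum_(A : {set I * J}) `|\sum_x (sgn A x : R) *: z x| ^+ 2.
  rewrite -(ler_pM2l (exprn_gt0 #|I| (ltr0n R 2))) [leRHS]mulrCA.
  rewrite (sum_cube_randomize (fun B : {set I} => [set x | x.1 \in B]%SET)).
  rewrite exchange_big !mulr_sumr/=; apply: ler_sum => A _.
  apply: le_trans (cI (u A)) _.
  rewrite le_eqVlt; apply/orP; left; apply/eqP; congr (_ * _).
  apply: eq_bigr => B _; rewrite uE; congr (`| _ | ^+ 2).
  apply: eq_bigr => i _; rewrite /u scaler_sumr; apply: eq_bigr => j _.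
  by rewrite sgn_translate scalerA; congr ((_ * _) *: _); rewrite /sgn inE.
have step2 i : 2 ^+ #|{: I * J}| * \sum_j `|z (i, j)| ^+ 2 <=
    K2 * \sum_(A : {set I * J}) `|u A i| ^+ 2.
  rewrite -(ler_pM2l (exprn_gt0 #|J| (ltr0n R 2))) [leRHS]mulrCA.
  rewrite (sum_cube_randomize (fun B : {set J} => [set x | x.2 \in B]%SET)).
  rewrite [leLHS]mulrCA -[leLHS]sum_cube [leRHS]mulr_sumr/=; apply: ler_sum => A _.
  have := cJ (fun j => (sgn A (i, j) : R) *: z (i, j)).
  have -> : \sum_j `|(sgn A (i, j) : R) *: z (i, j)| ^+ 2 = \sum_j `|z (i, j)| ^+ 2.
    by apply: eq_bigr => j _; rewrite normrZ normr_sgn mul1r.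
  move=> /le_trans; apply.
  rewrite le_eqVlt; apply/orP; left; apply/eqP; congr (_ * _).
  apply: eq_bigr => B _; congr (`| _ | ^+ 2).
  by apply: eq_bigr => j _; rewrite sgn_translate scalerA;
    congr ((_ * _) *: _); rewrite /sgn inE.
have -> : \sum_x `|z x| ^+ 2 = \sum_i \sum_j `|z (i, j)| ^+ 2.
  by rewrite pair_big/=; apply: eq_bigr => -[].
rewrite [K1 * K2]mulrC -mulrA mulr_sumr.
apply: le_trans (ler_sum _ (fun i _ => step2 i)) _.
by rewrite -mulr_sumr ler_wpM2l.
Qed.

Lemma cotype_bound_exp (R : realType) (X : normedModType R) (N k : nat) (K : R) :
  0 <= K -> cotype_bound X 'I_N K ->
  exists2 I : finType, #|I| = (N ^ k)%N & cotype_bound X I (K ^+ k).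
Proof.
move=> K0 cN; elim: k => [|k [I cardI cI]].
  exists unit; rewrite ?card_unit// => z.
  rewrite expr0 mul1r.
  rewrite (big_pred1 tt)/=; last by case.
  rewrite -sum_cube le_eqVlt; apply/orP; left; apply/eqP.
  apply: eq_bigr => A _.
  rewrite (big_pred1 tt)/=; last by case.
  by rewrite normrZ normr_sgn mul1r.
exists ('I_N * I)%type; first by rewrite card_prod card_ord cardI expnS.
by rewrite exprS; apply: cotype_bound_prod => //; exact: exprn_ge0.
Qed.

(** After division by [c] the coefficients are means of sign vectors under a Riesz product density,
    and the norm is convex. *)
Lemma norm_lincomb_le (R : realType) (X : normedModType R) (I : finType)
    (z : I -> X) (m c : R) (b : I -> R) :
  (forall A : {set I}, `|\sum_i (sgn A i : R) *: z i| <= m) ->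
  (forall i, `|b i| <= c) -> 0 <= c -> `|\sum_i b i *: z i| <= c * m.
Proof.
move=> zm bc; rewrite le_eqVlt => /orP[/eqP c0|c0].
  rewrite big1 ?normr0 -?c0 ?mul0r// => i _; apply/eqP.
  by rewrite scaler_eq0 -normr_le0 c0 bc.
pose a i := b i / c.
have a1 i : `|a i| <= 1.
  by rewrite normrM normfV (gtr0_norm c0) ler_pdivrMr ?mul1r.
pose rest j (A : {set I}) : R := \prod_(i | i != j) (1 + a i * sgn A i).
have restE j e : \sum_(A : {set I}) (1 + e * sgn A j) * rest j A = 2 ^+ #|I|.
  rewrite -(cube_kernel_sum (fun i => if i == j then e else a i)).
  apply: eq_bigr => A _; rewrite [RHS](bigD1 j)//= eqxx; congr (_ * _).
  by apply: eq_bigr => i /negbTE ->.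
have rest0 j : \sum_(A : {set I}) rest j A = 2 ^+ #|I|.
  by rewrite -(restE j 0); apply: eq_bigr => A _; rewrite mul0r addr0 mul1r.
have rest1 j : \sum_(A : {set I}) sgn A j * rest j A = 0.
  have := restE j 1; under eq_bigr do rewrite mul1r mulrDl mul1r.
  by rewrite big_split/= rest0 => /(canRL (addKr _)); rewrite addNr.
have zE : \sum_i a i *: z i = (2 ^+ #|I|)^-1 *: \sum_(A : {set I})
    (\prod_i (1 + a i * sgn A i)) *: \sum_i (sgn A i : R) *: z i.
  under [in RHS]eq_bigr do rewrite scaler_sumr.
  rewrite exchange_big/= scaler_sumr; apply: eq_bigr => j _.
  under [in RHS]eq_bigr do rewrite scalerA.
  rewrite -scaler_suml scalerA; congr (_ *: _).
  have -> : \sum_(A : {set I}) \prod_i (1 + a i * sgn A i) * sgn A j =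
      \sum_(A : {set I}) (sgn A j * rest j A + a j * rest j A).
    apply: eq_bigr => A _; rewrite (bigD1 j)//= -/(rest j A).
    by rewrite mulrAC mulrDl mul1r -mulrA sgn_mul mulr1 mulrDl.
  by rewrite big_split/= rest1 add0r -mulr_sumr rest0 mulrCA mulVf ?mulr1// expf_neq0.
have -> : \sum_i b i *: z i = c *: \sum_i a i *: z i.
  rewrite scaler_sumr; apply: eq_bigr => i _.
  by rewrite scalerA /a mulrC divfK// gt_eqF.
rewrite normrZ (gtr0_norm c0) ler_pM2l// zE normrZ gtr0_norm ?invr_gt0 ?exprn_gt0//.
rewrite ler_pdivrMl ?exprn_gt0// -(cube_kernel_sum a) mulr_suml.
rewrite (le_trans (ler_norm_sum _ _ _))//; apply: ler_sum => A _.
by rewrite normrZ ger0_norm ?cube_kernel_ge0// ler_wpM2l ?cube_kernel_ge0.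
Qed.

(** The upper bound is convexity. For the lower one, flip all coefficients but the largest, [a 0 j]:
    the flipped sum and [T a] add up to [(2 * a 0 j) *: e j], so [2 * (15 / 16) - 5 / 4 = 5 / 8]
    bounds [T] from below. *)
Lemma sign_sums_linfty (R : realType) (X : normedModType R) (n : nat)
    (z : 'I_(n + 2) -> X) :
  (forall i, 15 / 16 <= `|z i|) ->
  (forall A : {set 'I_(n + 2)}, `|\sum_i (sgn A i : R) *: z i| <= 5 / 4) ->
  exists2 E : set X, has_dim E n & lambda_isomorphic 'rV[R]_n 2 E.
Proof.
move=> z_ge z_le; pose e (i : 'I_n) := z (lshift 2 i).
pose T0 (a : 'rV[R]_n) := \sum_i a 0 i *: e i.
have T0lin : linear T0.
  move=> k a b; rewrite /T0 scaler_sumr -big_split/=; apply: eq_bigr => i _.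
  by rewrite !mxE scalerDl scalerA.
pose T : {linear 'rV[R]_n -> X} := HB.pack T0 (GRing.isLinear.Build _ _ _ _ T0 T0lin).
pose ext (a : 'I_n -> R) (i : 'I_(n + 2)) : R := if fintype.split i is inl j then a j else 0.
have extE a : \sum_i ext a i *: z i = \sum_i a i *: e i.
  rewrite big_split_ord/= [X in _ + X]big1 ?addr0 => [|i _].
    apply: eq_bigr => i _; rewrite /ext; case: split_ordP => j; first by move/lshift_inj ->.
    by move/eqP; rewrite eq_lrshift.
  rewrite /ext; case: split_ordP => j; last by rewrite scale0r.
  by move/eqP; rewrite eq_rlshift.
have coord_le (a : 'rV[R]_n) i : `|a 0 i| <= `|a|.
  by rewrite [`|a|]mx_normrE; exact: (le_bigmax _ (fun x : 'I_1 * 'I_n => `|a x.1 x.2|) (0, i)).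
have ext_le (a : 'rV[R]_n) i : `|ext (a 0) i| <= `|a|.
  by rewrite /ext; case: fintype.split => j; rewrite ?normr0// coord_le.
have T_le a : `|T a| <= 5 / 4 * `|a|.
  by rewrite mulrC -[T a]extE; apply: norm_lincomb_le => //; exact: ext_le.
have T_ge a : `|a| <= 8 / 5 * `|T a|.
  have [a0|a0] := eqVneq `|a| 0; first by rewrite a0 mulr_ge0.
  have [[i0 j] /= aj] : exists i, `|a| = `|a i.1 i.2| by exact: mx_norm_neq0.
  rewrite ord1 in aj.
  pose b i := if i == lshift 2 j then ext (a 0) i else - ext (a 0) i.
  have b_le i : `|b i| <= `|a| by rewrite /b; case: ifP; rewrite ?normrN ext_le.
  have := norm_lincomb_le z_le b_le (normr_ge0 _).
  have -> : \sum_i b i *: z i = (2 * a 0 j) *: e j - T a.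
    rewrite -[T a]extE (bigD1 (lshift 2 j))//= [in RHS](bigD1 (lshift 2 j))//=.
    rewrite opprD addrA -sumrN; congr (_ + _).
      have -> : ext (a 0) (lshift 2 j) = a 0 j.
        rewrite /ext; case: split_ordP => k; first by move/lshift_inj ->.
        by move/eqP; rewrite eq_lrshift.
      rewrite /b eqxx /ext -/(e j); case: split_ordP => k; last first.
        by move/eqP; rewrite eq_lrshift.
      by move/lshift_inj <-; rewrite -scalerBl mulr2n mulrDl mul1r addrK.
    by apply: eq_bigr => i /negbTE ij; rewrite /b ij scaleNr.
  have := ler_distD 0 ((2 * a 0 j) *: e j) (T a); rewrite subr0 sub0r normrN.
  have := lerB_dist ((2 * a 0 j) *: e j) (T a).
  rewrite normrZ normrM (@ger0_norm _ 2)// -aj.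
  have := z_ge (lshift 2 j); rewrite -/(e j).
  have := normr_ge0 a.
  move: `|_ - _| `|e j| `|T a| `|a| => x y t c; nra.
have T_inj : injective T.
  move=> a b ab; apply/eqP; rewrite -subr_eq0 -normr_le0 (le_trans (T_ge _))//.
  have -> : T (a - b) = 0 by rewrite linearB ab subrr.
  by rewrite normr0 mulr0.
have rowE (a : 'I_n -> R) : \sum_i a i *: e i = T (\row_i a i).
  by apply: eq_bigr => i _; rewrite mxE.
exists (range T).
  exists e; split.
    move=> a; rewrite rowE -(linear0 T) => /T_inj/rowP a0 i.
    by have := a0 i; rewrite !mxE.
  apply/seteqP; split => [_ [a _ <-]|_ [a _ <-]].
    by exists (a 0).
  by exists (\row_i a i); rewrite ?rowE.
exists T; split => //; exists (5 / 4), (8 / 5); split => //; lra.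
Qed.

(* Almost extremal vectors have sign sums of almost constant norm, the variance of
   this norm being tiny, and hence span a copy of l_oo^n. *)
Lemma cotype_or_linfty (R : realType) (X : normedModType R) :
  (exists N theta, [/\ (1 < N)%N, 0 < theta < 1 &
     cotype_bound X 'I_N (N%:R * theta : R)]) \/
  linfty_uniformly_contained X.
Proof.
apply: contrapT => /not_orP[nocotype]; apply.
exists 2 => n.
(* Two spare vectors ensure [1 < N] even for [n = 0]. *)
pose N := (n + 2)%N; pose M : R := 2 ^+ N.
have M0 : 0 < M by rewrite exprn_gt0.
have M1 : 1 <= M by rewrite exprn_ege1// ler1n.
have N1 : 1 <= N%:R :> R by rewrite ler1n /N addn2.
(* Smallness of [M * eta] lets the sum of all squared deviations control each single one; smallness
   of [N%:R * eta] bounds each single [z j] from below. *)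
pose eta : R := (32 * M * N%:R)^-1.
have eta0 : 0 < eta by rewrite invr_gt0 !mulr_gt0// (lt_le_trans ltr01).
have etaE : 32 * M * N%:R * eta = 1.
  by rewrite mulfV// !mulf_neq0// gt_eqF// (lt_le_trans ltr01).
have eta1 : N%:R * eta <= 1 / 32 by nra.
have eta2 : M * eta <= 1 / 32 by nra.
have eta3 : eta <= 1 / 32 by nra.
have [z zlt] : exists z : 'I_N -> X, N%:R * (1 - eta) *
    \sum_(A : {set 'I_N}) `|\sum_i (sgn A i : R) *: z i| ^+ 2 <
    M * \sum_i `|z i| ^+ 2.
  apply: contrapT => noz; apply: nocotype; exists N, (1 - eta); split.
  - by rewrite /N addn2.
  - by lra.
  move=> z; rewrite leNgt; apply/negP => zlt; apply: noz; exists z.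
  by move: zlt; rewrite card_ord.
pose v (A : {set 'I_N}) := `|\sum_i (sgn A i : R) *: z i|.
pose mu := M^-1 * \sum_(A : {set 'I_N}) v A.
have zmu j : `|z j| <= mu.
  have -> : z j = M^-1 *: \sum_(A : {set 'I_N}) (sgn A j : R) *: \sum_i (sgn A i : R) *: z i.
    under eq_bigr do rewrite scaler_sumr.
    rewrite exchange_big/= (bigD1 j)//= [X in _ + X]big1 ?addr0 => [|i ij].
      under eq_bigr do rewrite scalerA sgn_mul.
      rewrite -scaler_suml scalerA sum_cube card_ord mulr1 mulVf ?scale1r//.
      by rewrite gt_eqF.
    under eq_bigr do rewrite scalerA.
    rewrite -scaler_suml.
    have -> : \sum_(A : {set 'I_N}) sgn A j * sgn A i = 0 :> R.
      have := walsh_orthogonal (R := R) [set j]%SET [set i]%SET.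
      rewrite (inj_eq set1_inj) eq_sym (negbTE ij) => h; rewrite -[RHS]h.
      apply: eq_bigr => A _.
      by rewrite [walsh A _]walshC [walsh A [set i]%SET]walshC /walsh !big_set1.
    by rewrite scale0r.
  rewrite normrZ gtr0_norm ?invr_gt0// ler_pM2l ?invr_gt0//.
  rewrite (le_trans (ler_norm_sum _ _ _))// ler_sum// => A _.
  by rewrite normrZ normr_sgn mul1r.
have mu_ge0 : 0 <= mu by rewrite mulr_ge0 ?invr_ge0 ?(ltW M0)//; apply: sumr_ge0 => A _; exact: normr_ge0.
have zsum_le : \sum_i `|z i| ^+ 2 <= N%:R * mu ^+ 2.
  rewrite mulr_natl -[in leRHS](card_ord N) -sumr_const ler_sum// => i _.
  by rewrite lerXn2r ?nnegrE.
pose S := \sum_(A : {set 'I_N}) v A ^+ 2.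
(* Near extremality says that the second moment of [v] barely exceeds the square of its mean. *)
have S_lt : (1 - eta) * S < M * mu ^+ 2.
  rewrite -(ltr_pM2l (lt_le_trans ltr01 N1)) mulrA (lt_le_trans zlt)//.
  by rewrite mulrCA ler_pM2l.
have vsum : \sum_(A : {set 'I_N}) v A = M * mu by rewrite mulrA mulfV ?mul1r// gt_eqF.
have var : \sum_(A : {set 'I_N}) (v A - mu) ^+ 2 = S - M * mu ^+ 2.
  have vE A : (v A - mu) ^+ 2 = v A ^+ 2 + mu ^+ 2 - 2 * mu * v A by ring.
  under eq_bigr do rewrite vE.
  by rewrite sumrB big_split/= sum_cube card_ord -mulr_sumr vsum -/S -/M; ring.
have SM : M * mu ^+ 2 <= S.
  by rewrite -subr_ge0 -var; apply: sumr_ge0 => A _; exact: sqr_ge0.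
have mu0 : 0 < mu.
  rewrite lt_neqAle mu_ge0 andbT; apply/negP => /eqP mu0.
  by move: S_lt SM; rewrite -mu0; nra.
have v_le A : v A <= 5 / 4 * mu.
  have : (v A - mu) ^+ 2 <= 1 / 16 * mu ^+ 2.
    apply: (@le_trans _ _ (S - M * mu ^+ 2)).
      rewrite -var (bigD1 A)//= lerDl; apply: sumr_ge0 => B _; exact: sqr_ge0.
    have mu2 : 0 < mu ^+ 2 by rewrite exprn_gt0.
    have SS : S <= 2 * M * mu ^+ 2 by nra.
    have : S - M * mu ^+ 2 <= eta * S by lra.
    move=> /le_trans; apply.
    apply: (@le_trans _ _ (eta * (2 * M * mu ^+ 2))); first by rewrite ler_pM2l.
    nra.
  by have := normr_ge0 (\sum_i (sgn A i : R) *: z i); rewrite -/(v A); nra.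
(* The other terms of the square sum are at most [mu ^+ 2] each, so near extremality leaves almost
   [mu ^+ 2] for the term at [j]. *)
have z_ge j : 15 / 16 * mu <= `|z j|.
  have z2 : 31 / 32 * mu ^+ 2 <= `|z j| ^+ 2.
    have : \sum_i `|z i| ^+ 2 <= `|z j| ^+ 2 + (N%:R - 1) * mu ^+ 2.
      rewrite (bigD1 j)//= lerD2l.
      apply: (@le_trans _ _ (\sum_(i < N | i != j) mu ^+ 2)).
        by apply: ler_sum => i _; rewrite lerXn2r ?nnegrE.
      rewrite sumr_const -[(mu ^+ 2) *+ _]mulr_natl ler_wpM2r ?sqr_ge0//.
      rewrite cardC1 card_ord -(natrB _ (_ : 1 <= N)%N) ?subn1//.
      by rewrite /N addn2.
    have : N%:R * (1 - eta) * mu ^+ 2 <= \sum_i `|z i| ^+ 2.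
      rewrite -(ler_pM2l M0) mulrCA; apply: le_trans (ltW zlt).
      by rewrite ler_wpM2l// mulr_ge0 ?ler0n//; lra.
    have : N%:R * eta * mu ^+ 2 <= 1 / 32 * mu ^+ 2 by rewrite ler_wpM2r ?sqr_ge0.
    by lra.
  have := normr_ge0 (z j); nra.
apply: (@sign_sums_linfty R X n (fun i => mu^-1 *: z i)).
  by move=> i; rewrite normrZ gtr0_norm ?invr_gt0// ler_pdivlMl// mulrC.
move=> A.
have -> : \sum_i (sgn A i : R) *: (mu^-1 *: z i) = mu^-1 *: \sum_i (sgn A i : R) *: z i.
  by rewrite scaler_sumr; apply: eq_bigr => i _; rewrite !scalerA mulrC.
by rewrite normrZ gtr0_norm ?invr_gt0// ler_pdivrMl// mulrC v_le.
Qed.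

(** * Covering and packing *)

(** A cover by at most [Q] sets of diameter at most [s], encoded as a colouring, so that iterated
    covers are colourings by product types. *)
Definition coverable (R : realType) (X : normedModType R) (S : set X)
    (Q : nat) (s : R) :=
  exists (T : finType) (c : X -> T), (#|T| <= Q)%N /\
    forall v w, S v -> S w -> c v = c w -> `|v - w| <= s.

Definition unit_ball_of (R : realType) (X : normedModType R) (E : set X) : set X :=
  [set v | E v /\ `|v| <= 1].

(** Subtracting a representative of the class of [v] and dividing by [2 * s ^+ k] gives a point of
    the unit ball, which is classified again. The factor 2 bounds the diameter of the ball, at
    [k = 0]. *)
Lemma coverable_exp (R : realType) (X : normedModType R) (E : set X) Q (s : R) k :
  is_subspace E -> 0 < s -> coverable (unit_ball_of E) Q s ->
  coverable (unit_ball_of E) (Q ^ k) (2 * s ^+ k).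
Proof.
move=> subE s0 [T [c [cT cs]]]; elim: k => [|k [Tk [ck [cTk cks]]]].
  exists unit, (fun=> tt); split; first by rewrite card_unit.
  move=> v w [_ v1] [_ w1] _; rewrite (le_trans (ler_normB _ _))//.
  by rewrite expr0 mulr1 mulr2n lerD.
pose rep (t : Tk) : X := xget 0 [set v | unit_ball_of E v /\ ck v = t].
have repP v : unit_ball_of E v -> unit_ball_of E (rep (ck v)) /\ ck (rep (ck v)) = ck v.
  by move=> Bv; rewrite /rep; case: xgetP => [//|/(_ v)[]].
pose r : R := 2 * s ^+ k.
have r0 : 0 < r by rewrite mulr_gt0 ?exprn_gt0.
pose loc v := r^-1 *: (v - rep (ck v)).
exists (Tk * T)%type, (fun v => (ck v, c (loc v))); split.
  by rewrite card_prod expnSr leq_mul.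
have locP v : unit_ball_of E v -> unit_ball_of E (loc v).
  move=> Bv; have [Brep ckrep] := repP _ Bv; split.
    by apply: subspaceZ => //; apply: subspaceB => //; [case: Bv|case: Brep].
  by rewrite normrZ gtr0_norm ?invr_gt0// ler_pdivrMl// mulr1 cks.
move=> v w Bv Bw [ckvw /(cs _ _ (locP _ Bv) (locP _ Bw))].
rewrite -scalerBr ckvw opprB addrA subrK normrZ.
rewrite gtr0_norm ?invr_gt0// ler_pdivrMl// => /le_trans; apply.
by rewrite /r exprSr mulrA.
Qed.

Lemma expr_lt_eventually (R : realType) (x y : R) :
  0 <= x < 1 -> 0 < y -> exists k, x ^+ k < y.
Proof.
move=> /andP[x0 x1] y0.
have /cvgrPdist_lt/(_ _ y0) : (x ^+ k) @[k --> \oo] --> 0.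
  by apply: cvg_expr; rewrite ger0_norm.
case=> k _ /(_ k (leqnn k)); rewrite sub0r normrN ger0_norm ?exprn_ge0// => ?.
by exists k.
Qed.

(* A ball of radius [s] has at most [s ^ d] times the volume of the unit ball;
   the volumes are replaced by counting grid points after iterating the cover. *)
Lemma coverable_card_ge (R : realType) (X : normedModType R) (E : set X) d
    (e : 'I_d -> X) (eta : R) Q (s : R) :
  is_subspace E -> (forall i, E (e i)) -> 0 < eta ->
  (forall a i, eta * `|a i| <= `|\sum_i a i *: e i|) ->
  0 < s -> coverable (unit_ball_of E) Q s -> 1 <= Q%:R * s ^+ d.
Proof.
move=> subE Ee eta0 e_ge s0 covQ; rewrite leNgt; apply/negP => x1.
pose S := \sum_i `|e i| + 1.
have S0 : 0 < S by rewrite ltr_wpDl ?sumr_ge0.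
(* The grid below has [G.+1 ^ d] points, and [(G.+1%:R * s ^+ k) ^+ d] is at least this constant
   whatever [k] is. *)
pose c0 := (eta / (3 * S)) ^+ d.
have c00 : 0 < c0 by rewrite exprn_gt0// divr_gt0// mulr_gt0.
have [|k] := @expr_lt_eventually R (Q%:R * s ^+ d) c0 _ c00.
  by rewrite x1 mulr_ge0// exprn_ge0// ltW.
apply/negP; rewrite -leNgt.
have [T [c [cT cs]]] := coverable_exp k subE s0 covQ.
have sk0 : 0 < s ^+ k by rewrite exprn_gt0.
(* With this mesh, distinct grid points are at distance at least [eta * th = 3 * s ^+ k], more than
   the bound [2 * s ^+ k] within a class. *)
pose th := 3 * s ^+ k / eta.
have th0 : 0 < th by rewrite divr_gt0// mulr_gt0.
have thn_ge0 (n : nat) : 0 <= th * n%:R by rewrite mulr_ge0// ltW.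
pose G := Num.truncn (th * S)^-1.
have thS0 : 0 < th * S by rewrite mulr_gt0.
have /andP[G_le G_gt] : G%:R <= (th * S)^-1 < G.+1%:R.
  by apply: truncn_itv; rewrite invr_ge0 ltW.
pose u (n : {ffun 'I_d -> 'I_G.+1}) := \sum_i (th * (n i)%:R) *: e i.
have uB n : unit_ball_of E (u n).
  split; first exact: subspace_sum.
  rewrite (le_trans (ler_norm_sum _ _ _))//.
  apply: (@le_trans _ _ (th * G%:R * \sum_i `|e i|)).
    rewrite mulr_sumr ler_sum// => i _.
    rewrite normrZ ger0_norm ?thn_ge0// ler_wpM2r// ler_pM2l// ler_nat.
    by rewrite -ltnS.
  apply: (@le_trans _ _ (th * G%:R * S)).
    by rewrite ler_wpM2l ?thn_ge0// lerDl.
  by rewrite mulrAC -ler_pdivlMl// mulr1.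
have u_inj : injective (fun n => c (u n)).
  move=> n m /(cs _ _ (uB n) (uB m)) unm; apply/ffunP => i; apply/val_inj.
  apply/eqP; apply: contraT => nm.
  move: unm; rewrite leNgt => /negP[].
  have -> : u n - u m = \sum_i (th * ((n i)%:R - (m i)%:R)) *: e i.
    by rewrite -sumrB; apply: eq_bigr => j _; rewrite -scalerBl mulrBr.
  apply: lt_le_trans (e_ge _ i).
  rewrite normrM gtr0_norm// mulrA (mulrC eta) divfK ?gt_eqF//.
  have : 1 <= `|(n i)%:R - (m i)%:R| :> R.
    move: nm => /=; rewrite neq_ltn => /orP[lt|lt].
      by rewrite distrC -natrB 1?ltnW// ger0_norm// ler1n subn_gt0.
    by rewrite -natrB 1?ltnW// ger0_norm// ler1n subn_gt0.
  by nra.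
have card_le : ((G.+1 ^ d) <= Q ^ k)%N.
  by rewrite -[X in (X ^ d)%N]card_ord -[X in (_ ^ X)%N](card_ord d) -card_ffun
    (leq_trans (leq_card _ u_inj)).
rewrite exprMn -natrX exprAC.
apply: (@le_trans _ _ ((G.+1 ^ d)%:R * (s ^+ k) ^+ d)); last first.
  by rewrite ler_wpM2r ?(exprn_ge0 d (ltW sk0))// ler_nat.
rewrite natrX -exprMn /c0 lerXn2r ?nnegrE ?divr_ge0 ?mulr_ge0 ?(ltW eta0) ?(ltW S0) ?(ltW sk0)//.
apply: (@le_trans _ _ ((th * S)^-1 * s ^+ k)); last by rewrite ler_pM2r// ltW.
rewrite /th le_eqVlt; apply/orP; left; apply/eqP; field.
by rewrite !gt_eqF.
Qed.

(** The [f l] separate the points of [E], so the matrix of the values [f l (e i)] has a right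
    inverse [W], which recovers coordinates from the values [f l v] with explicit bounds. *)
Lemma bounded_basis (R : realType) (X : normedModType R) (E : set X) d
    (L : finType) (f : L -> {linear X -> R^o}) (C1 C3 : R) :
  has_dim E d -> (forall l v, E v -> `|f l v| <= C1 * `|v|) ->
  (forall v, E v -> `|v| <= C3 * \sum_l `|f l v|) ->
  exists (e : 'I_d -> X) (eta : R), [/\ forall i, E (e i), 0 < eta &
    forall a i, eta * `|a i| <= `|\sum_i a i *: e i|].
Proof.
move=> dimE; have subE := has_dim_subspace dimE; move: dimE => [e [eI eE]] f_le f_ge.
have Ee i : E (e i).
  rewrite eE; exists (fun j => (j == i)%:R) => //=.
  rewrite (bigD1 i)//= eqxx scale1r big1 ?addr0// => j /negbTE ->.
  by rewrite scale0r.
have Esum (a : 'I_d -> R) : E (\sum_i a i *: e i) by exact: subspace_sum.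
pose M : 'M[R]_(d, #|L|) := \matrix_(i, j) f (enum_val j) (e i).
have fM (a : 'rV_d) j : (a *m M) 0 j = f (enum_val j) (\sum_i a 0 i *: e i).
  rewrite mxE linear_sum; apply: eq_bigr => i _.
  by rewrite linearZ !mxE.
have /row_freeP[W MW] : row_free M.
  rewrite -kermx_eq0; apply/rowV0P => a /sub_kermxP aM.
  apply/rowP => i; rewrite mxE; apply: eI.
  apply/eqP; rewrite -normr_le0 (le_trans (f_ge _ (Esum _)))//.
  rewrite big1 ?mulr0// => l _; apply/eqP; rewrite normr_eq0.
  by rewrite -(enum_rankK l) -fM aM mxE.
pose w := \sum_j \sum_i `|W j i|.
have w_ge0 : 0 <= w by apply: sumr_ge0 => j _; exact: sumr_ge0.
pose c := `|C1| * w + 1.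
have c0 : 0 < c by rewrite ltr_wpDl ?mulr_ge0.
exists e, c^-1; split => //; first by rewrite invr_gt0.
move=> a i; rewrite ler_pdivrMl//.
pose v := \sum_i a i *: e i; rewrite -/v.
pose ra : 'rV_d := \row_i a i.
have -> : a i = (ra *m M *m W) 0 i by rewrite -mulmxA MW mulmx1 mxE.
rewrite mxE (le_trans (ler_norm_sum _ _ _))//.
apply: (@le_trans _ _ (\sum_j `|C1| * `|v| * `|W j i|)).
  apply: ler_sum => j _; rewrite normrM ler_wpM2r// fM.
  have -> : \sum_i0 ra 0 i0 *: e i0 = v by apply: eq_bigr => ? _; rewrite mxE.
  by rewrite (le_trans (f_le _ _ (Esum _)))// ler_wpM2r// ler_norm.
rewrite -mulr_sumr /c mulrDl mul1r mulrAC (@le_trans _ _ (`|C1| * w * `|v|))// ?lerDl//.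
rewrite ler_wpM2r// ler_wpM2l// ler_sum// => j _.
by rewrite (bigD1 i)//= lerDl sumr_ge0.
Qed.

(** Greedy choice. If it stops early, the sets where all [f l (v - g i)] are at most [w] in absolute
    value cover the unit ball; rescaled by [w], each is covered by [K] classes, which contradicts
    the volume count. *)
Lemma packing_exists (R : realType) (X : normedModType R) (E : set X) d
    (L : finType) (f : L -> {linear X -> R^o}) (C1 C3 rho w : R) (K N : nat) :
  has_dim E d -> (forall l v, E v -> `|f l v| <= C1 * `|v|) ->
  (forall v, E v -> `|v| <= C3 * \sum_l `|f l v|) ->
  0 < rho -> 0 < w ->
  coverable [set v | E v /\ forall l, `|f l v| <= 1] K rho ->
  N%:R * K%:R * (w * rho) ^+ d < 1 ->
  exists g : nat -> X, (forall i, unit_ball_of E (g i)) /\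
    forall i j, (i < N)%N -> (j < N)%N -> i != j ->
      exists l, w < `|f l (g i - g j)|.
Proof.
move=> dimE f_le f_ge rho0 w0 [T [c [cT cs]]] NKd.
have subE := has_dim_subspace dimE.
have [e [eta [Ee eta0 e_ge]]] := bounded_basis dimE f_le f_ge.
suff [g [gB gsep]] : exists g : nat -> X, (forall i, unit_ball_of E (g i)) /\
    forall i j, (i < j)%N -> (j < N)%N -> exists l, w < `|f l (g i - g j)|.
  exists g; split => // i j iN jN; rewrite neq_ltn => /orP[ij|ji].
    exact: gsep.
  by have [l] := gsep _ _ ji iN; exists l; rewrite -normrN -linearN opprB.
have B0 : unit_ball_of E 0 by split; [case: subE|rewrite normr0].
suff H n : (n <= N)%N -> exists g : nat -> X, (forall i, unit_ball_of E (g i)) /\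
    forall i j, (i < j)%N -> (j < n)%N -> exists l, w < `|f l (g i - g j)|.
  exact: H.
elim: n => [_|n IH nN]; first by exists (fun=> 0).
have [g [gB gsep]] := IH (ltnW nN).
have [[b [bB bsep]]|nob] := pselect (exists b, unit_ball_of E b /\
    forall i, (i < n)%N -> exists l, w < `|f l (g i - b)|).
  exists (fun i => if (i < n)%N then g i else b); split => [i|i j ij].
    by case: ifP.
  rewrite ltnS leq_eqVlt => /orP[/eqP jn|jn]; last by rewrite (ltn_trans ij jn) jn; exact: gsep.
  by rewrite -jn ij jn ltnn; apply: bsep; rewrite -jn.
exfalso; case: n => [|n] in IH nN gsep nob *; first by apply: nob; exists 0.
have /choice[idx idxP] : forall v, exists i : 'I_n.+1, unit_ball_of E v ->
    forall l, `|f l (v - g i)| <= w.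
  move=> v; apply: contrapT => noi; apply: nob; exists v; split.
    by apply: contrapT => vB; apply: noi; exists ord0.
  move=> i iN; apply: contrapT => nol; apply: noi; exists (Ordinal iN) => _ l.
  rewrite leNgt; apply/negP => lt; apply: nol; exists l.
  by rewrite -normrN -linearN opprB.
have : coverable (unit_ball_of E) (n.+1 * K) (w * rho).
  exists ('I_n.+1 * T)%type, (fun v => (idx v, c (w^-1 *: (v - g (idx v))))); split.
    by rewrite card_prod card_ord leq_mul2l cT orbT.
  have locP v : unit_ball_of E v ->
      [set v | E v /\ forall l, `|f l v| <= 1] (w^-1 *: (v - g (idx v))).
    move=> Bv; split.
      by apply: subspaceZ => //; apply: subspaceB => //; [case: Bv|case: (gB (idx v))].
    move=> l; rewrite linearZ/= normrM gtr0_norm ?invr_gt0// ler_pdivrMl// mulr1.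
    exact: idxP.
  move=> v v' Bv Bv' [idxE] /(cs _ _ (locP _ Bv) (locP _ Bv')).
  rewrite -scalerBr idxE opprB addrA subrK.
  by rewrite normrZ gtr0_norm ?invr_gt0// ler_pdivrMl.
move=> /(coverable_card_ge subE Ee eta0 e_ge (mulr_gt0 w0 rho0)).
rewrite leNgt => /negP; apply; apply: le_lt_trans NKd.
rewrite natrM !ler_wpM2r ?exprn_ge0 ?mulr_ge0 ?(ltW w0) ?(ltW rho0)// ler_nat.
exact: ltnW.
Qed.

(** * Shattering of a separated family by the coordinate functionals *)

(** Cutting the range of the [f l] into levels of height [w / 2] turns [w]-separation into a gap of
    at least two levels, so [large_shattered] applies. Thresholds are the middles of levels, whence
    the margin [w / 4]. *)
Lemma shattered_signs (R : realType) (X : normedModType R) (L I : finType)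
    (f : L -> {linear X -> R^o}) (C1 w : R) (N D ex : nat) (g : nat -> X) :
  0 < w -> (forall l i, `|f l (g i)| <= C1) ->
  (forall i j, (i < N)%N -> (j < N)%N -> i != j ->
      exists l, w < `|f l (g i - g j)|) ->
  (#|L| * (Num.truncn (4 * C1 / w)).+1 + 2 <= 2 ^ ex)%N ->
  (2 ^ (ex * (D * ex).+1) <= N)%N -> (#|I| <= D)%N ->
  exists (h : I -> L) (G : {set I} -> nat) (th : I -> R),
    forall A i, w / 4 <= sgn A i * (f (h i) (g (G A)) - th i).
Proof.
move=> w0 f_le sep exP NP ID.
pose p := (Num.truncn (4 * C1 / w)).+1; pose u := w / 2.
have u0 : 0 < u by rewrite divr_gt0.
have val_ge0 l i : 0 <= (f l (g i) + C1) / u.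
  rewrite divr_ge0 ?(ltW u0)//.
  by have := f_le l i; rewrite ler_norml => /andP[+ _]; rewrite -subr_ge0 opprK.
have lvl_lt l i : (Num.truncn ((f l (g i) + C1) / u) < p)%N.
  rewrite ltnS le_truncn// /u invf_div mulrA ler_pM2r ?invr_gt0//.
  by have := f_le l i; rewrite ler_norml => /andP[_]; lra.
pose lvl (i : 'I_N) : {ffun L -> 'I_p} := [ffun l => Ordinal (lvl_lt l i)].
have lvl_itv l i : (lvl i l)%:R * u <= f l (g i) + C1 < (lvl i l).+1%:R * u.
  rewrite ffunE/= -ler_pdivlMr// -ltr_pdivrMr//; exact: truncn_itv.
have lvl_sep i j : i != j -> exists l,
    (((lvl i l).+1 < lvl j l) || ((lvl j l).+1 < lvl i l))%N.
  move=> ij; have [|l] := sep i j (ltn_ord i) (ltn_ord j).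
    by [].
  rewrite linearB/= => lt; exists l.
  have := lvl_itv l i; have := lvl_itv l j.
  move: lt; rewrite (_ : w = 2 * u); last by rewrite /u mulrC divfK.
  have gap (a b : R) (m n : nat) : m%:R * u <= a + C1 < m.+1%:R * u ->
      n%:R * u <= b + C1 < n.+1%:R * u -> 2 * u < a - b -> (n.+1 < m)%N.
    move=> /andP[_ am] /andP[bn _] ab; rewrite -ltnS -(ltr_nat R) -(ltr_pM2r u0).
    by apply: le_lt_trans am; move: bn; rewrite -!natr1; lra.
  move=> lt jI iI; move: lt; rewrite ltr_normr => /orP[lt|lt]; apply/orP.
    by right; exact: gap iI jI lt.
  by left; apply: gap jI iI _; rewrite -opprB.
have lvl_inj : injective lvl.
  move=> i j ij; apply/eqP; apply: contraT => /lvl_sep[l].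
  by rewrite ij orbb ltnNge leqnSn.
have [|||s sh Ds] := @large_shattered L p D ex [set lvl i | i : 'I_N]%SET.
- move=> _ _ /imsetP[i _ ->] /imsetP[j _ ->] ij.
  by apply: lvl_sep; apply: contraNneq ij => ->.
- exact: exP.
- by rewrite card_imset// card_ord.
have Isupp : (#|I| <= #|supp s|)%N by rewrite (leq_trans ID)// ltnW.
pose h (i : I) := enum_val (widen_ord Isupp (enum_rank i)).
have h_inj : injective h.
  by move=> i j /enum_val_inj/(congr1 val)/= /val_inj/enum_rank_inj.
have sh_supp i : exists v, s (h i) = Some v.
  have := enum_valP (widen_ord Isupp (enum_rank i)); rewrite -/(h i) inE.
  by case: (s (h i)) => // v _; exists v.
have [lev levP] := choice sh_supp.
have ex_G (A : {set I}) : exists k : 'I_N, forall i,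
    if i \in A then (lvl k (h i) < lev i)%N else (lev i < lvl k (h i))%N.
  (* The complement appears because [sgn A i] is -1 on [A]. *)
  move/forallP: sh => /(_ [set h i | i in ~: A]%SET)/existsP[_ /andP[/imsetP[k _ ->]]].
  move=> /forallP kP; exists k => i; have := kP (h i).
  by rewrite levP mem_imset// inE; case: (i \in A).
have [G GP] := choice ex_G.
exists h, (fun A => G A), (fun i => ((lev i)%:R + 2^-1) * u - C1) => A i.
have := lvl_itv (h i) (G A); have := GP A i.
rewrite /sgn; case: (i \in A) => /= lt /andP[ge le].
  have : (lvl (G A) (h i)).+1%:R * u <= (lev i)%:R * u by rewrite ler_pM2r// ler_nat.
  rewrite expr1 /u in le *; lra.
have : (lev i).+1%:R * u <= (lvl (G A) (h i))%:R * u by rewrite ler_pM2r// ler_nat.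
by rewrite -natr1 expr0 /u in ge *; lra.
Qed.

(** * Quantization *)

(** The [z i] are the Rademacher coefficients of the family indexed by the shattered signs.
    Shattering bounds them from below; the cotype bound and the Rademacher projection bound their
    square sum from above. *)
Lemma packing_bound (R : realType) (X : normedModType R) (E : set X)
    (L I : finType) (f : L -> {linear X -> R^o}) (C1 C3 w K M : R)
    (N D ex : nat) (g : nat -> X) (s : seq (R * R)) :
  is_subspace E -> (forall i, unit_ball_of E (g i)) ->
  0 < C1 -> (forall l v, E v -> `|f l v| <= C1 * `|v|) ->
  (forall v, E v -> `|v| <= C3 * \sum_l `|f l v|) ->
  0 < w ->
  (forall i j, (i < N)%N -> (j < N)%N -> i != j ->
      exists l, w < `|f l (g i - g j)|) ->
  (#|L| * (Num.truncn (4 * C1 / w)).+1 + 2 <= 2 ^ ex)%N ->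
  (2 ^ (ex * (D * ex).+1) <= N)%N -> (#|I| <= D)%N ->
  0 <= K -> cotype_bound X I K ->
  (forall p, p \in s -> 0 <= p.2 <= 1) ->
  (forall k, `|moment_defect s k| <= M) ->
  #|I|%:R * (w / 4) ^+ 2 <=
    C1 ^+ 2 * (K * (2 * (\sum_(p <- s) `|p.1|) ^+ 2 +
                    2 * (C3 * #|L|%:R * C1 * M) ^+ 2)).
Proof.
move=> subE gB C10 f_le f_ge w0 sep exP NP ID K0 cI s01 sM.
have fg l i : `|f l (g i)| <= C1.
  have [Eg g1] := gB i.
  by rewrite (le_trans (f_le _ _ Eg))// ler_piMr// ltW.
have [h [G [th hG]]] := shattered_signs w0 fg sep exP NP ID.
pose z := rademacher_coef (fun A => g (G A)).
have N0 : 0 < 2 ^+ #|I| :> R by rewrite exprn_gt0.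
have Ez i : E (z i).
  by apply: subspaceZ => //; apply: subspace_sum => // A; case: (gB (G A)).
(* The threshold [th i] drops out because the signs at [i] sum to 0. *)
have z_ge i : w / 4 <= f (h i) (z i).
  have -> : f (h i) (z i) = (2 ^+ #|I|)^-1 *
      \sum_(A : {set I}) sgn A i * (f (h i) (g (G A)) - th i).
    rewrite linearZ linear_sum/=; congr (_ * _).
    under [RHS]eq_bigr do rewrite mulrBr.
    rewrite sumrB -mulr_suml sum_sgn mul0r subr0.
    by apply: eq_bigr => A _; rewrite linearZ.
  by rewrite ler_pdivlMl// -sum_cube ler_sum.
have w2_le i : (w / 4) ^+ 2 <= C1 ^+ 2 * `|z i| ^+ 2.
  rewrite -exprMn lerXn2r ?nnegrE ?mulr_ge0 ?(ltW C10) ?(ltW w0) ?invr_ge0//.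
  by rewrite (le_trans (z_ge i))// (le_trans (ler_norm _))// f_le.
apply: (@le_trans _ _ (C1 ^+ 2 * \sum_i `|z i| ^+ 2)).
  by rewrite mulr_sumr mulr_natl -sumr_const ler_sum.
rewrite ler_wpM2l ?sqr_ge0// -(ler_pM2l N0).
rewrite (le_trans (cI z))// [leRHS]mulrCA ler_wpM2l//.
apply: (rademacher_projection_le (f := f) subE) => //.
- by move=> A; case: (gB (G A)).
- by move=> A; case: (gB (G A)).
Qed.

(** * Choice of the parameters: nodes, exponents and scales *)

Lemma expr_ge_eventually (R : realType) (a y : R) : 1 < a ->
  exists k0, forall k, (k0 <= k)%N -> y <= a ^+ k.
Proof.
move=> a1; have a0 : 0 < a by exact: lt_trans a1.
have [y0|y0] := leP y 0.
  by exists 0%N => k _; rewrite (le_trans y0)// exprn_ge0// ltW.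
have [||k0 k0P] := @expr_lt_eventually R a^-1 y^-1.
- by rewrite invr_ge0 ltW//= invf_lt1.
- by rewrite invr_gt0.
exists k0 => k k0k; rewrite (@le_trans _ _ (a ^+ k0))//.
  by move: k0P; rewrite exprVn ltf_pV2 ?posrE ?exprn_gt0// => /ltW.
by rewrite ler_weXn2l// ltW.
Qed.

(** Multiplying the nodes and dividing the weights by [t] multiplies the [k]-th moment by
    [t^-1 * t ^+ k]: moments up to degree [q.+1] are unchanged and higher ones become small, at the
    price of the total weight [c / t]. *)
Lemma scaled_nodes (R : realType) (q : nat) :
  exists2 c : R, 0 <= c & forall t, 0 < t <= 1 ->
    exists s : seq (R * R), [/\ forall p, p \in s -> 0 <= p.2 <= 1,
      \sum_(p <- s) `|p.1| = c / t &
      forall k, `|moment_defect s k| <= c * t ^+ q.+1].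
Proof.
have [s [s01 sk]] := derivative_nodes R q.
exists (\sum_(p <- s) `|p.1|) => [|t /andP[t0 t1]]; first exact: sumr_ge0.
have t_ge0 := ltW t0.
exists [seq (p.1 / t, t * p.2) | p <- s]; split.
- move=> _ /mapP[p /s01/andP[p0 p1] ->]/=.
  by rewrite mulr_ge0//= mulr_ile1.
- rewrite big_map mulr_suml; apply: eq_bigr => p _.
  by rewrite normrM normfV (gtr0_norm t0).
move=> k; rewrite /moment_defect big_map/=.
have -> : \sum_(p <- s) p.1 / t * (t * p.2) ^+ k =
    t^-1 * t ^+ k * \sum_(p <- s) p.1 * p.2 ^+ k.
  by rewrite mulr_sumr; apply: eq_bigr => p _; rewrite exprMn; ring.
have [kq|qk] := ltnP k q.+2.
  rewrite sk//; case: (k =P 1%N) => [->|_]; last first.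
    by rewrite mulr0 subrr normr0 mulr_ge0 ?exprn_ge0// sumr_ge0.
  by rewrite expr1 mulVf ?gt_eqF// mulr1 subrr normr0 mulr_ge0 ?exprn_ge0// sumr_ge0.
case: k qk => // k qk; rewrite gtn_eqF ?(leq_trans _ qk)// subr0.
rewrite exprS mulKf ?gt_eqF// normrM ger0_norm ?exprn_ge0// mulrC ler_pM ?exprn_ge0//.
  rewrite (le_trans (ler_norm_sum _ _ _))// big_seq [leRHS]big_seq ler_sum// => p /s01/andP[p0 p1].
  by rewrite normrM ler_piMr// ger0_norm ?exprn_ge0// exprn_ile1.
by rewrite ler_wiXn2l.
Qed.

Lemma sqrn_le_exp2 k : (4 <= k)%N -> (k * k <= 2 ^ k)%N.
Proof.
elim: k => // k IH; rewrite leq_eqVlt => /orP[/eqP <- //|k4].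
have := IH k4; rewrite expnS; nia.
Qed.

(** The left side is [m] times the exponent of the family size needed to shatter [D] coordinates;
    [D * D <= d] and [k * k <= D] absorb the factors polynomial in [k]. *)
Lemma exponent_le (N0 m e0 k d : nat) (D := (N0 ^ k)%N) :
  (1 < N0)%N -> (4 <= k)%N -> (0 < e0)%N -> (2 * m * e0 ^ 2 <= k)%N ->
  (N0 ^ (2 * k) <= d)%N ->
  (m * (e0 * k * (D * (e0 * k)).+1) <= k * d)%N.
Proof.
move=> N01 k4 e00 ck dP.
have D_ge : (k * k <= D)%N.
  by rewrite (leq_trans (sqrn_le_exp2 k4))// leq_exp2r// (leq_trans _ k4).
have DD : (D * D <= d)%N by rewrite /D -expnD addnn -mul2n.
have D0 : (0 < D)%N by rewrite expn_gt0 (ltnW N01).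
have step : ((D * (e0 * k)).+1 <= 2 * (D * (e0 * k)))%N.
  by rewrite mul2n -addnn -addn1 leq_add2l !muln_gt0 D0 e00 (leq_trans _ k4).
apply: (@leq_trans (m * (e0 * k * (2 * (D * (e0 * k)))))).
  by rewrite !leq_mul2l step !orbT.
apply: (@leq_trans (k * ((2 * m * e0 ^ 2) * k * D))).
  by rewrite leq_eqVlt; apply/orP; left; apply/eqP; rewrite expnS expn1; ring.
rewrite leq_mul2l (leq_trans _ DD) ?orbT// leq_mul2r (leq_trans _ D_ge) ?orbT//.
by rewrite leq_mul2r ck orbT.
Qed.

(** Suppose [K] is at most [b ^+ d], where [b = a ^+ k]. With [D = N0 ^ k] shattered coordinates,
    and after division by [D], [packing_bound] puts a multiple of b^-8 below a multiple of
    [theta ^+ k * b ^+ 2], hence of b^-14, which fails for large [k]. *)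
Lemma no_large_quantization (R : realType) (X : normedModType R) (N0 : nat)
    (theta a C1 C3 rho : R) :
  (1 < N0)%N -> 0 < theta -> cotype_bound X 'I_N0 (N0%:R * theta) ->
  1 < a -> a ^+ 16 * theta <= 1 -> 0 < C1 -> 0 < rho ->
  exists k0, forall k d (L : finType) (E : set X) (f : L -> {linear X -> R^o}) K,
    (k0 <= k)%N -> has_dim E d ->
    (forall l v, E v -> `|f l v| <= C1 * `|v|) ->
    (forall v, E v -> `|v| <= C3 * \sum_l `|f l v|) ->
    coverable [set v | E v /\ forall l, `|f l v| <= 1] K rho ->
    (N0 ^ (2 * k) <= d)%N -> (#|L| <= N0 ^ (8 * k))%N ->
    a ^+ (k * d) < K%:R.
Proof.
move=> N01 theta0 cot a1 a16 C10 rho0.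
have a0 : 0 < a by exact: lt_trans a1.
(* This order lets the moment error [b^-1 ^+ q.+1] absorb the factor [#|L| <= N0 ^ (8 * k)]. *)
have [q qP] := expr_ge_eventually (N0%:R ^+ 8) a1.
have {qP} qP : N0%:R ^+ 8 <= a ^+ q.+1 by exact: qP.
have [Cq Cq0 nodes] := scaled_nodes R q.
have two1 : 1 < 2 :> R by rewrite ltr1n.
have [c1 /(_ _ (leqnn _)) c1P] := expr_ge_eventually (4 * C1 + 1) two1.
have [c2 /(_ _ (leqnn _)) c2P] := expr_ge_eventually (a ^+ 4) two1.
have [m /(_ _ (leqnn _)) mP] := expr_ge_eventually 2 a1.
pose C5 := (C3 * C1 * Cq) ^+ 2.
pose C6 := 32 * C1 ^+ 2 * (Cq ^+ 2 + C5).
have [k1 k1P] := expr_ge_eventually rho a1.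
have [k2 k2P] := expr_ge_eventually (C6 + 1) a1.
(* The summands pay in turn for [#|L|], [4 * C1 + 1], [b ^+ 4] and the additive 2 in the condition
   of [shattered_signs]. *)
pose e0 := (8 * N0 + c1 + c2 + 2)%N.
exists (maxn (maxn (maxn 4 k1) k2) (2 * m * e0 ^ 2)) => k d L E f K k0k dimE f_le f_ge cov dP LP.
rewrite ltNge; apply/negP => KP.
have subE := has_dim_subspace dimE.
(* [b] is a small power of [d]; the separation scale is [b ^ -4] and the noise
   parameter is [1 / b]. *)
pose b := a ^+ k.
move: k0k; rewrite !geq_max => /andP[/andP[/andP[k4 /k1P b_rho] /k2P b_C6] kc].
rewrite -/b in b_rho b_C6.
have k0 : (0 < k)%N by exact: leq_trans k4.
have b1 : 1 < b by rewrite exprn_egt1// -lt0n.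
have b0 : 0 < b by exact: lt_trans b1.
have bV0 : 0 < b^-1 by rewrite invr_gt0.
pose w := b^-1 ^+ 4.
have w0 : 0 < w by rewrite exprn_gt0.
pose D := (N0 ^ k)%N; pose ex := (e0 * k)%N; pose N := (2 ^ (ex * (D * ex).+1))%N.
have d0 : (0 < d)%N by rewrite (leq_trans _ dP)// expn_gt0 (ltnW N01).
have expo : (m * (ex * (D * ex).+1) <= k * d)%N.
  by apply: exponent_le => //; rewrite /e0 addn2.
(* Both [N] and [K] are at most [b ^+ d], while [rho <= b] gives [w * rho <= b^-1 ^+ 3]. *)
have NK : N%:R * K%:R * (w * rho) ^+ d < 1.
  have N_le : N%:R <= b ^+ d.
    rewrite natrX -exprM (le_trans _ (ler_weXn2l (ltW a1) expo))//.
    by rewrite [leRHS]exprM lerXn2r ?nnegrE ?exprn_ge0// ltW.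
  have K_le : K%:R <= b ^+ d by rewrite -exprM.
  have wr_le : (w * rho) ^+ d <= (b^-1 ^+ 3) ^+ d.
    rewrite lerXn2r ?nnegrE ?exprn_ge0 ?mulr_ge0 ?(ltW w0) ?(ltW rho0) ?(ltW bV0)//.
    apply: (@le_trans _ _ (w * b)); first by rewrite ler_pM2l.
    by rewrite /w exprSr -mulrA mulVf ?gt_eqF// mulr1.
  apply: (@le_lt_trans _ _ (b ^+ d * b ^+ d * (b^-1 ^+ 3) ^+ d)).
    rewrite ler_pM ?mulr_ge0 ?ler_pM// exprn_ge0// mulr_ge0 ?(ltW w0) ?(ltW rho0)//.
  rewrite -(exprMn d b b) -(exprMn d (b * b)) (_ : b * b * b^-1 ^+ 3 = b^-1).
    by rewrite exprn_ilt1 ?(ltW bV0) ?invf_lt1// -lt0n.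
  by field; rewrite gt_eqF.
have [g [gB gsep]] := packing_exists dimE f_le f_ge rho0 w0 cov NK.
have exP : (#|L| * (Num.truncn (4 * C1 / w)).+1 + 2 <= 2 ^ ex)%N.
  have tr_le : ((Num.truncn (4 * C1 / w)).+1 <= 2 ^ (c1 + c2 * k))%N.
    rewrite -(ler_nat R) -natr1.
    apply: (@le_trans _ _ (4 * C1 / w + 1)).
      have C1_ge0 : 0 <= 4 * C1 by rewrite mulr_ge0// ltW.
      by rewrite lerD2r truncn_le; apply: (divr_ge0 C1_ge0 (ltW w0)).
    have b41 : 1 <= b ^+ 4 by rewrite exprn_ege1// ltW.
    rewrite /w exprVn invrK natrX exprD exprM.
    apply: (@le_trans _ _ ((4 * C1 + 1) * b ^+ 4)).
      by rewrite [leRHS]mulrDl mul1r lerD2l.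
    apply: ler_pM => //; first by rewrite addr_ge0// mulr_ge0// ltW.
      by rewrite exprn_ge0// ltW.
    by rewrite /b exprAC lerXn2r ?nnegrE ?exprn_ge0// ltW.
  have L_le : (#|L| <= 2 ^ (8 * N0 * k))%N.
    rewrite (leq_trans LP)// -mulnA mulnCA [(2 ^ _)%N]expnM.
    by rewrite leq_exp2r ?muln_gt0// ltnW// ltn_expl.
  apply: (@leq_trans (2 ^ (8 * N0 * k + (c1 + c2 * k)) + 2)).
    by rewrite leq_add2r expnD leq_mul.
  apply: (@leq_trans (2 ^ (8 * N0 * k + (c1 + c2 * k) + 2))).
    have add2 y : (0 < y)%N -> (y + 2 <= y * 2 ^ 2)%N by clear; lia.
    by rewrite [leqRHS]expnD add2// expn_gt0.
  rewrite leq_exp2l// /ex /e0; move: k0; move: (8 * N0)%N; clear.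
  by case: k => // k A _; rewrite mulnS; nia.
have Kth0 : 0 <= N0%:R * theta by rewrite mulr_ge0// ltW.
have [I cardI cotI] := cotype_bound_exp k Kth0 cot.
have [|s [s01 s_sum s_mom]] := nodes b^-1.
  by rewrite bV0/= invf_le1// ltW.
have ID : (#|I| <= D)%N by rewrite cardI.
have := packing_bound subE gB C10 f_le f_ge w0 gsep exP (leqnn _) ID
  (exprn_ge0 k Kth0) cotI s01 s_mom.
have Dpos : 0 < D%:R :> R by rewrite ltr0n expn_gt0 (ltnW N01).
have -> : (N0%:R * theta) ^+ k = D%:R * theta ^+ k by rewrite exprMn natrX.
rewrite s_sum cardI -/D -[_ * theta ^+ k * _]mulrA [leRHS]mulrCA ler_pM2l//.
apply/negP; rewrite -ltNge.
have thb : theta ^+ k * b ^+ 16 <= 1.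
  by rewrite /b exprAC -exprMn mulrC exprn_ile1// mulr_ge0 ?exprn_ge0// ltW.
have L1 : 0 <= #|L|%:R * b^-1 ^+ q.+1 <= 1.
  rewrite mulr_ge0 ?exprn_ge0 ?(ltW bV0)//=.
  rewrite exprVn ler_pdivrMr ?exprn_gt0// mul1r.
  apply: (@le_trans _ _ ((N0 ^ (8 * k))%:R)); first by rewrite ler_nat.
  by rewrite natrX exprM /b [leRHS]exprAC lerXn2r ?nnegrE ?exprn_ge0// ltW.
have err_le : (C3 * #|L|%:R * C1 * (Cq * b^-1 ^+ q.+1)) ^+ 2 <= C5.
  have -> : C3 * #|L|%:R * C1 * (Cq * b^-1 ^+ q.+1) =
      C3 * C1 * Cq * (#|L|%:R * b^-1 ^+ q.+1) by ring.
  move: L1 => /andP[L0 L1]; rewrite exprMn ler_piMr ?sqr_ge0//.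
  by rewrite exprn_ile1.
(* The factor [b ^+ 16] absorbs [theta ^+ k]; it remains to compare [b ^+ 8] with [C6 * b ^+ 2]. *)
rewrite invrK -(ltr_pM2r (exprn_gt0 16 b0)).
have -> : (w / 4) ^+ 2 * b ^+ 16 = b ^+ 8 / 16 by rewrite /w; field; rewrite gt_eqF.
set err := _ ^+ 2 in err_le *.
have C5_ge0 : 0 <= C5 by exact: sqr_ge0.
have b2 : 1 <= b ^+ 2 by rewrite exprn_ege1// ltW.
apply: (@le_lt_trans _ _ (C6 / 16 * b ^+ 2)).
  have -> : C1 ^+ 2 * (theta ^+ k * (2 * (Cq * b) ^+ 2 + 2 * err)) * b ^+ 16 =
      theta ^+ k * b ^+ 16 * (C1 ^+ 2 * (2 * (Cq * b) ^+ 2 + 2 * err)) by ring.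
  apply: (@le_trans _ _ (C1 ^+ 2 * (2 * (Cq * b) ^+ 2 + 2 * err))).
    apply: ler_piMl thb; apply: mulr_ge0; first exact: sqr_ge0.
    by apply: addr_ge0; apply: mulr_ge0 => //; exact: sqr_ge0.
  have -> : C6 / 16 * b ^+ 2 = C1 ^+ 2 * (2 * (Cq * b) ^+ 2 + 2 * (C5 * b ^+ 2)).
    by rewrite /C6; field.
  apply: ler_wpM2l; first exact: sqr_ge0.
  by rewrite lerD2l ler_pM2l//; apply: (le_trans err_le); exact: ler_peMr.
rewrite mulrAC ltr_pM2r ?invr_gt0// (exprD b 6 2) ltr_pM2r ?exprn_gt0//.
apply: (@lt_le_trans _ _ b); first by lra.
by rewrite -[leLHS]expr1 ler_eXn2l.
Qed.

(** * The frame and the cover given by its quantization *)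

(** For fixed [v] the terms of a convergent series are bounded, hence so are the [f i v], as the
    [x i] stay away from 0; Banach-Steinhaus makes the bound uniform. *)
Lemma frame_coefficients_bounded (R : realType) (X : completeNormedModType R)
    (x : nat -> X) (f : nat -> {linear X -> R^o}) (b : R) :
  0 < b -> (forall i, b <= `|x i|) -> schauder_frame x f ->
  exists2 C1 : R, 0 < C1 & forall i v, `|f i v| <= C1 * `|v|.
Proof.
move=> b0 bx [fcont fsum].
have fbnd i : bounded_fun_norm (f i).
  have /linear_bounded_continuous/linear_boundedP[M [_ MP]] := fcont i.
  move=> s; exists ((`|M| + 1) * s) => v vs.
  have /MP : M < `|M| + 1 by rewrite ltr_pwDr// ler_norm.
  by move=> /(_ v)/le_trans; apply; rewrite ler_wpM2l.
have unif : uniform_bounded (range (fun i => (f i : X -> R^o))).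
  apply: Banach_Steinhauss => [_ [i _ <-]|v].
    by split => //; exact: linearP.
  have /cvg_seq_bounded/pinfty_ex_gt0[M M0 MP] :
      cvgn (fun n => \sum_(i < n) f i v *: x i).
    by apply/cvg_ex; exists v; exact: fsum.
  exists (2 * M / b) => _ [i _ <-]; rewrite ler_pdivlMr//.
  apply: (@le_trans _ _ (`|f i v *: x i|)).
    by rewrite normrZ ler_wpM2l.
  have -> : f i v *: x i = \sum_(j < i.+1) f j v *: x j - \sum_(j < i) f j v *: x j.
    by rewrite big_ord_recr/= addrAC subrr add0r.
  rewrite (le_trans (ler_normB _ _))// mulrDl mul1r lerD//; exact: MP.
have [M MP] := unif 1.
exists (`|M| + 1); first by rewrite ltr_wpDl.
move=> i v; have [->|v0] := eqVneq v 0; first by rewrite linear0 !normr0 mulr0.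
have nv0 : 0 < `|v| by rewrite normr_gt0.
have : `|f i (`|v|^-1 *: v)| <= M.
  apply: MP; first by exists i.
  by rewrite normrZ gtr0_norm ?invr_gt0// mulVf// gt_eqF.
rewrite linearZ/= normrM gtr0_norm ?invr_gt0// ler_pdivrMl// mulrC => /le_trans; apply.
by rewrite ler_pM2r// (le_trans (ler_norm M))// lerDl.
Qed.

Lemma absz_shift_inj (k1 k2 : int) (m : nat) :
  (`|k1| <= m)%N -> (`|k2| <= m)%N ->
  `|(k1 + m%:Z)%R|%N = `|(k2 + m%:Z)%R|%N -> k1 = k2.
Proof. lia. Qed.

Lemma absz_shift_lt (k : int) (m : nat) :
  (`|k| <= m)%N -> (`|(k + m%:Z)%R| < (2 * m).+1)%N.
Proof. lia. Qed.

(** The class of [v] is the integer vector quantizing its frame sum. Equal classes put two frame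
    sums within [2 * eps]; applying [P] and the lower bound [r] returns to the vectors at the cost
    of the factor [M / r]. *)
Lemma quantized_cover (R : realType) (X : normedModType R) (P : {linear X -> X})
    (n : nat) (x : 'I_n -> X) (f : 'I_n -> {linear X -> R^o})
    (M r delta eps C : R) :
  0 < r -> 0 < delta -> 0 <= M -> (forall v, `|P v| <= M * `|v|) ->
  is_subspace (range P) ->
  (forall v, range P v -> r * `|v| <= `|P (\sum_i f i v *: x i)|) ->
  (forall v : X, [set \sum_i a i *: x i | a in
                   [set a : 'I_n -> R | forall i, `|a i| <= 1]] v ->
     exists k : 'I_n -> int, `|v - \sum_i (delta * (k i)%:~R) *: x i| < eps /\
       forall i, `|k i|%:~R * delta <= C) ->
  coverable [set v | range P v /\ forall i, `|f i v| <= 1]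
    ((2 * Num.truncn (C / delta)).+1 ^ n) (2 * M * eps / r).
Proof.
move=> r0 delta0 M0 P_le subE T_ge hc; set B := [set v | _].
pose kb := Num.truncn (C / delta).
have /choice[k kP] : forall v, exists k : 'I_n -> int, B v ->
    `|\sum_i f i v *: x i - \sum_i (delta * (k i)%:~R) *: x i| < eps /\
    forall i, (`|k i| <= kb)%N.
  move=> v; have [Bv|nBv] := pselect (B v); last by exists (fun=> 0) => /nBv.
  have [|k [k_eps k_C]] := hc (\sum_i f i v *: x i).
    by exists (fun i => f i v) => //; case: Bv.
  exists k => _; split => // i.
  have kC : (`|k i|%N)%:R <= C / delta by rewrite ler_pdivlMr// natr_absz.
  by rewrite /kb truncn_ge_nat// (le_trans _ kC).
pose c v : {ffun 'I_n -> 'I_(2 * kb).+1} := [ffun i => inord `|(k v i + kb%:Z)%R|%N].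
exists {ffun 'I_n -> 'I_(2 * kb).+1}, c; split.
  by rewrite card_ffun !card_ord.
move=> v w Bv Bw /ffunP cvw.
have [v_eps v_kb] := kP v Bv; have [w_eps w_kb] := kP w Bw.
have kE i : k v i = k w i.
  have := cvw i; rewrite !ffunE => /(congr1 val)/=.
  by rewrite !inordK ?absz_shift_lt// => /absz_shift_inj; apply.
have PB : range P (v - w) by apply: subspaceB => //; [case: Bv|case: Bw].
rewrite ler_pdivlMr// mulrC (le_trans (T_ge _ PB))// (le_trans (P_le _))//.
rewrite [2 * M]mulrC -mulrA ler_wpM2l//.
have -> : \sum_i f i (v - w) *: x i =
    \sum_i f i v *: x i - \sum_i f i w *: x i.
  by rewrite -sumrB; apply: eq_bigr => i _; rewrite linearB scalerBl.
pose y : X := \sum_i (delta * (k v i)%:~R) *: x i.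
rewrite (le_trans (ler_distD y _ _))// mulrDl mul1r lerD//; first exact: ltW.
have -> : y = \sum_i (delta * (k w i)%:~R) *: x i by under eq_bigr do rewrite -kE.
by rewrite distrC ltW.
Qed.

Theorem corollary5p14 (R : realType) (X : completeNormedModType R)
    (hX : pi_lambda_property X)
    (P : nat -> {linear X -> X}) (hP : approximating_projections P)
    (x : nat -> X) (f : nat -> {linear X -> R^o}) (hxf : schauder_frame x f)
    (hx : bounded_set (range x))
    (L : nat -> nat) (L_gt0 : forall n, (0 < L n)%N) (hL : increasing_seq L)
    (r delta eps C : R)
    (hr : 0 < r < 1) (hdelta : 0 < delta < 1) (heps : 0 < eps < 1)
    (ha : forall n (v : X), range (P n) v ->
      `|v - \sum_(i < L n) f i v *: P n (x i)| <= (1 - r) * `|v|)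
    (hb : forall n i, (i < L n)%N -> r <= `|P n (x i)|)
    (hc : forall n (v : X),
      [set \sum_(i < L n) a i *: x i |
         a in [set a : 'I_(L n) -> R | forall i, `|a i| <= 1]] v ->
      exists k : 'I_(L n) -> int,
        `|v - \sum_(i < L n) (delta * (k i)%:~R) *: x i| < eps /\
        forall i, `|k i|%:~R * delta <= C) :
  (exists c : R, 0 < c /\
     forall n, c * (lin_dim (range (P n)))%:R * ln (lin_dim (range (P n)))%:R
               <= (L n)%:R) \/
  linfty_uniformly_contained X.
Proof.
have [[N0 [theta [N01 /andP[theta0 theta1] cot]]]|] := cotype_or_linfty X; last by right.
left; case: hP => Pproj [M' P_le'] _.
move: hr hdelta heps => /andP[r0 r1] /andP[delta0 _] /andP[eps0 _].
pose M := `|M'| + 1.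
have M0 : 0 < M by rewrite ltr_wpDl.
have P_le n v : `|P n v| <= M * `|v|.
  by rewrite (le_trans (P_le' n v))// ler_wpM2r// (le_trans (ler_norm _))// lerDl.
have [B B0 x_le] : exists2 B : R, 0 < B & forall i, `|x i| <= B.
  move: hx => /pinfty_ex_gt0[B B0 xB]; exists B => // i.
  by apply: xB; exists i.
(* Every index [i] is thus below [L i], so (b) with [n = i] bounds all the [x i] away from 0. *)
have L_ge n : (n < L n)%N.
  elim: n => [|n IH]; first exact: L_gt0.
  by apply: leq_ltn_trans IH _; rewrite ltnNge [(_ <= _)%N](hL n.+1 n) ltnn.
have [C1 C10 f_le] : exists2 C1 : R, 0 < C1 & forall i v, `|f i v| <= C1 * `|v|.
  apply: (@frame_coefficients_bounded R X x f (r / M)) hxf; first by rewrite divr_gt0.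
  by move=> i; rewrite ler_pdivrMr// mulrC (le_trans (hb _ _ (L_ge i))).
pose C3 := M * B / r.
(* By (a), truncated reconstruction followed by [P n] is within [1 - r] of the identity on the
   range. *)
have T_ge n v : range (P n) v -> r * `|v| <= `|P n (\sum_(i < L n) f i v *: x i)|.
  move=> /ha; set u := \sum_(i < _) _ => hau.
  have -> : P n (\sum_(i < L n) f i v *: x i) = u.
    by rewrite linear_sum; apply: eq_bigr => i _; rewrite linearZ.
  by have := ler_normD (v - u) u; rewrite subrK; move: hau; rewrite mulrBl mul1r; lra.
have f_ge n v : range (P n) v -> `|v| <= C3 * \sum_(i < L n) `|f i v|.
  move=> Pv; rewrite /C3 mulrAC ler_pdivlMr// mulrC (le_trans (T_ge _ _ Pv))//.
  rewrite (le_trans (P_le _ _))// -mulrA ler_wpM2l ?(ltW M0)//.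
  rewrite (le_trans (ler_norm_sum _ _ _))// mulr_sumr ler_sum// => i _.
  by rewrite normrZ mulrC ler_wpM2r.
pose Kc := (2 * Num.truncn (C / delta)).+1.
have dimP n : has_dim (range (P n)) (lin_dim (range (P n))).
  by have [_ _ [d dimd]] := Pproj n; rewrite (lin_dimE dimd).
have cov n := quantized_cover r0 delta0 (ltW M0) (P_le n)
  (has_dim_subspace (dimP n)) (T_ge n) (hc n).
(* The largest [a] with [a ^+ 16 * theta <= 1]. *)
pose a := expR (- ln theta / 16).
have a1 : 1 < a by rewrite expR_gt1 divr_gt0// oppr_gt0 ln_lt0// theta0.
have a16 : a ^+ 16 * theta <= 1.
  by rewrite -expRM_natr divfK// expRN lnK// mulVf// gt_eqF.
have rho0 : 0 < 2 * M * eps / r by rewrite divr_gt0// !mulr_gt0.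
have [k0 no_large] := @no_large_quantization R X N0 theta a C1 C3 _ N01 theta0 cot
  a1 a16 C10 rho0.
have [b0 /(_ _ (leqnSn _)) bP] := expr_ge_eventually Kc%:R a1.
(* The successor makes [b] positive, since [c] involves its inverse. *)
pose b := b0.+1.
have lnN0 : 0 < ln (N0%:R : R) by rewrite ln_gt0// ltr1n.
pose Dm : R := (N0 ^ (2 * k0.+1))%:R.
have Dm1 : 1 <= Dm by rewrite ler1n expn_gt0 (ltnW N01).
(* If [L n] were below [c * d * ln d], the three terms would give in turn [L n <= d * d],
   [b * L n <= k * d] for large [d], and [L n < 1] for small [d]. *)
pose c := Num.min 1 (Num.min (4 * b%:R * ln N0%:R)^-1 (Dm ^+ 2)^-1).
have c0 : 0 < c.
  rewrite !lt_min ltr01 !invr_gt0 exprn_gt0 ?(lt_le_trans ltr01 Dm1)//= andbT.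
  by rewrite !mulr_gt0.
exists c; split=> // n; set d := lin_dim _.
have c1 : c <= 1 by rewrite ge_min lexx.
have c2 : c * (4 * b%:R * ln N0%:R) <= 1.
  by rewrite -ler_pdivlMr ?mulr_gt0// mul1r !ge_min lexx orbT.
have c3 : c * Dm ^+ 2 <= 1.
  rewrite -ler_pdivlMr ?exprn_gt0 ?(lt_le_trans ltr01)// mul1r !ge_min lexx.
  by rewrite !orbT.
have [->|] := posnP d; first by rewrite mulr0 mul0r.
move=> d0; rewrite leNgt; apply/negP => L_lt.
have dR0 : 0 < d%:R :> R by rewrite ltr0n.
have lnd_le : ln d%:R <= d%:R :> R by rewrite ltW// ln_sublinear.
have lnd_ge0 : 0 <= ln d%:R :> R by rewrite ln_ge0// ler1n.
have p1 : (1 < N0 ^ 2)%N by rewrite (ltn_exp2l 0).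
(* Base [N0 ^ 2] makes [N0 ^ k] at most the square root of [d], as needed for the number of
   shattered coordinates. *)
have /andP[d_ge d_lt] := trunc_log_bounds p1 d0.
move: (trunc_log _ _) d_ge d_lt => k; rewrite -!expnM => d_ge d_lt.
have [kk0|k0k] := leqP k k0.
  have : (d <= N0 ^ (2 * k0.+1))%N.
    by rewrite (leq_trans (ltnW d_lt))// leq_exp2l// leq_mul2l.
  rewrite -(ler_nat R) -/Dm => d_le.
  have : 1 <= (L n)%:R :> R by rewrite ler1n.
  rewrite leNgt => /negP; apply; apply: lt_le_trans L_lt _.
  apply: le_trans c3; rewrite -mulrA ler_pM2l// expr2 ler_pM//.
  exact: le_trans lnd_le d_le.
have kpos : (0 < k)%N by exact: leq_ltn_trans k0k.
have lnd_k : ln d%:R <= 4 * k%:R * ln N0%:R :> R.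
  apply: (@le_trans _ _ (ln (N0%:R ^+ (2 * k.+1)))).
    by rewrite ler_ln ?posrE ?exprn_gt0 ?ltr0n ?(ltnW N01)// -natrX ler_nat ltnW.
  rewrite lnXn ?ltr0n ?(ltnW N01)// -[leLHS]mulr_natl ler_pM2r// -natrM ler_nat.
  by move: kpos; clear; lia.
have bL : (b * L n <= k * d)%N.
  rewrite -(ler_nat R) natrM [leRHS]natrM.
  apply: (@le_trans _ _ (b%:R * (c * d%:R * (4 * k%:R * ln N0%:R)))).
    by rewrite ler_pM2l// (le_trans (ltW L_lt))// ler_pM2l// mulr_gt0.
  have -> : b%:R * (c * d%:R * (4 * k%:R * ln N0%:R)) =
      c * (4 * b%:R * ln N0%:R) * (k%:R * d%:R) by ring.
  by rewrite ler_piMl// mulr_ge0.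
have L_le : (#|'I_(L n)| <= N0 ^ (8 * k))%N.
  rewrite card_ord; apply: (@leq_trans (d * d)).
    rewrite -(ler_nat R) natrM (le_trans (ltW L_lt))// ler_pM//; first by rewrite mulr_ge0// ltW.
    by rewrite ler_piMl.
  rewrite (leq_trans (leq_mul (ltnW d_lt) (ltnW d_lt)))// -expnD leq_exp2l//.
  by move: kpos; clear; lia.
have := no_large k d 'I_(L n) (range (P n)) (fun i => f i) (Kc ^ L n)%N (ltnW k0k)
  (dimP n) (fun l v _ => f_le l v) (f_ge n) (cov n) d_ge L_le.
rewrite ltNge => /negP; apply.
rewrite natrX (le_trans _ (ler_weXn2l (ltW a1) bL))// exprM.
by rewrite lerXn2r ?nnegrE ?exprn_ge0 ?(ltW (lt_trans ltr01 a1)).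
Qed.
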